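(* Let $S$ be a closed nonnegative symmetric, not necessarily densely defined, operator in a separable complex Hilbert space $\mathfrak H$, and assume that $S$ admits disjoint nonnegative selfadjoint (operator) extensions. Then there exists a pair $\{\widetilde S_0,\widetilde S_1\}$ of nonnegative selfadjoint extensions of $S$ such that (1) $\widetilde S_0\cap\widetilde S_1=S$; (2) the sesquilinear form $\widetilde S_0[\cdot,\cdot]$ is a closed restriction of the form $\widetilde S_1[\cdot,\cdot]$; (3) $\inf\{\widetilde S_1[u-\varphi]:\ \varphi\in\mathcal D[\widetilde S_0]\}=0$ for all $u\in\mathcal D[\widetilde S_1]$. Moreover, if $n_\pm(S)=\infty$, then there exists a pair $\{\widetilde S_0,\widetilde S_1\}$ with properties (1)-(3) which differs from the pair $\{S_{\rm F},S_{\rm K}\}$.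
   Context: A linear relation (l.r.) in $\mathfrak H$ is a linear subspace of $\mathfrak H\times\mathfrak H$; operators are identified with their graphs, and extensions and intersections are understood in the sense of graphs. A l.r. $T$ is nonnegative if $(f',f)\ge 0$ for all $\{f,f'\}\in T$. A selfadjoint extension of $S$ is in general a selfadjoint linear relation containing the graph of $S$. Two extensions $S',S''$ of $S$ are disjoint if $S'\cap S''=S$. A nonnegative selfadjoint relation $T$ decomposes as $T=T_s\oplus(\{0\}\times\operatorname{mul}T)$, where $\operatorname{mul}T=\{f':\{0,f'\}\in T\}$ and $T_s$ is a nonnegative selfadjoint operator in $\overline{\operatorname{dom}}\,T$. Its closed form is $T[u,v]=(T_s^{1/2}u,T_s^{1/2}v)$ with domain $\mathcal D[T]=\operatorname{dom}T_s^{1/2}$, and $T[u]:=T[u,u]$. ''$\widetilde S_0[\cdot,\cdot]$ is a closed restriction of $\widetilde S_1[\cdot,\cdot]$'' means $\mathcal D[\widetilde S_0]\subset\mathcal D[\widetilde S_1]$ and $\widetilde S_0[u,v]=\widetilde S_1[u,v]$ for $u,v\in\mathcal D[\widetilde S_0]$. For a nonnegative l.r. $S$, the Friedrichs extension $S_{\rm F}$ is the nonnegative selfadjoint relation associated with the closure of the form $S(\varphi,\psi)=(\varphi',\psi)$, $\{\varphi,\varphi'\}\in S$, $\psi\in\operatorname{dom}S$; the Kreĭn–von Neumann extension is $S_{\rm K}=((S^{-1})_{\rm F})^{-1}$. The numbers $n_\pm(S)=\dim(\mathfrak H\ominus\operatorname{ran}(S\pm iI))$ are the defect numbers of $S$;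 for nonnegative $S$ they are both equal to $\dim(\mathfrak H\ominus\operatorname{ran}(S+I))$. *)

(* Defs.v *)
From HB Require Import structures.
From mathcomp Require Import all_boot all_order all_algebra.
From mathcomp Require Import complex.
From mathcomp Require Import all_classical all_reals all_analysis.

Set Implicit Arguments.
Unset Strict Implicit.
Unset Printing Implicit Defensive.

Import Order.TTheory GRing.Theory Num.Theory numFieldNormedType.Exports.

Local Open Scope classical_set_scope.
Local Open Scope ring_scope.

Section LinearRelations.
Variables (R : realType) (H : completeNormedModType R[i]).
(* Linear in the first argument, conjugate-linear in the second. *)
Variable ip : {dot H for Num.conj}.
Implicit Types (S T A B : set (H * H)) (K D : set H).

Definition separable := exists D, countable D /\ dense D.

Definition linear_relation T :=
  T 0 /\ forall (a : R[i]) p q, T p -> T q -> T (a *: p + q).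

Definition mul T : set H := [set h | T (0, h)].

Definition is_operator T := mul T = [set 0].

(* The order of R[i] is partial: 0 <= z means that z is real and nonnegative. *)
Definition nonnegative T := forall p, T p -> 0 <= ip p.2 p.1.

(* The adjoint computed in the closed subspace K; K = setT gives the adjoint
   in H. *)
Definition adjoint_in K T : set (H * H) :=
  [set q | [/\ K q.1, K q.2 & forall p, T p -> ip p.2 q.1 = ip p.1 q.2]].

Definition adjoint T := adjoint_in setT T.

Definition symmetric_relation T := T `<=` adjoint T.

Definition selfadjoint_in K T := T = adjoint_in K T.

Definition selfadjoint T := selfadjoint_in setT T.

Definition nonneg_sa_extension S T :=
  [/\ S `<=` T, selfadjoint T & nonnegative T].

(* T_s in T = T_s (+) ({0} x mul T). *)
Definition op_part T : set (H * H) :=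
  [set p | T p /\ forall h, mul T h -> ip p.2 h = 0].

Definition is_sqrt_in K A B :=
  [/\ selfadjoint_in K B, nonnegative B, is_operator B
    & (B \; B)%relation = A].

(* T_s^{1/2}, an operator in the Hilbert space closure (dom T). *)
Definition sqrt_op_part T : set (H * H) :=
  xget set0 [set B | is_sqrt_in (closure (T.`1)) (op_part T) B].

(* Some f' with {f, f'} in T: the value at f when T is an operator. *)
Definition rel_val T (f : H) : H := xget 0 [set f' | T (f, f')].

(* form_val is only meaningful on form_dom. *)
Record form := Form { form_dom : set H; form_val : H -> H -> R[i] }.
Implicit Type t : form.

(* T[u, v] = (T_s^{1/2} u, T_s^{1/2} v). *)
Definition closed_form T : form :=
  let B := sqrt_op_part T in
  Form (B.`1) (fun u v => ip (rel_val B u) (rel_val B v)).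

Definition form_restriction (t0 t1 : form) :=
  form_dom t0 `<=` form_dom t1 /\
  forall u v, form_dom t0 u -> form_dom t0 v ->
    form_val t0 u v = form_val t1 u v.

(* S(f, g) = (f', g) for {f, f'} in S and g in dom S; for nonnegative S it does
   not depend on the choice of f', as mul S is orthogonal to dom S. *)
Definition rel_form S : form := Form (S.`1) (fun f g => ip (rel_val S f) g).

(* phi n --> u in H with t[phi n - phi m] --> 0. *)
Definition form_approx t (u : H) (phi : nat -> H) :=
  [/\ forall n, form_dom t (phi n),
      phi n @[n --> \oo] --> u
    & (fun nm : nat * nat =>
         form_val t (phi nm.1 - phi nm.2) (phi nm.1 - phi nm.2) : R[i]^o)
        @ (\oo, \oo) --> (0 : R[i]^o)].

(* The closure of a closable form; for such a form the limit below does not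
   depend on the chosen approximating sequences. *)
Definition form_closure t : form :=
  let approx u := xget (fun=> 0) [set phi | form_approx t u phi] in
  Form [set u | exists phi, form_approx t u phi]
       (fun u v => lim ((form_val t (approx u n) (approx v n) : R[i]^o)
                          @[n --> \oo])).

(* The relation associated with a closed nonnegative form by the first
   representation theorem. *)
Definition form_relation t : set (H * H) :=
  [set p | form_dom t p.1 /\
     forall v, form_dom t v -> form_val t p.1 v = ip p.2 v].

Definition Friedrichs S : set (H * H) :=
  form_relation (form_closure (rel_form S)).

Definition Krein S : set (H * H) := ((Friedrichs S^-1)^-1)%relation.

(* H (-) ran (S + z I). *)
Definition defect_space S (z : R[i]) : set H :=
  [set h | forall p, S p -> ip (p.2 + z *: p.1) h = 0].

Definition finite_dim (D : set H) :=
  exists (n : nat) (e : 'I_n -> H),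
    D `<=` range (fun c : 'I_n -> R[i] => \sum_(k < n) c k *: e k).

(* The infimum is taken in the extended reals, so that it has no default
   value; the values T1[u - phi] are real, and Re is the coercion to R. *)
Definition disjoint_restriction_pair S (T0 T1 : set (H * H)) :=
  let t0 := closed_form T0 in let t1 := closed_form T1 in
  [/\ nonneg_sa_extension S T0, nonneg_sa_extension S T1,
      T0 `&` T1 = S,
      form_restriction t0 t1
    & forall u, form_dom t1 u ->
        ereal_inf [set (complex.Re (form_val t1 (u - phi) (u - phi)))%:E
                  | phi in form_dom t0] = 0%E].

End LinearRelations.

(* Main.v *)
(* A nonnegative selfadjoint relation T is encoded by its resolvent
   G = (T + 1)^{-1}, an operator with 0 <= G <= 1, and the domain of its form is
   ran G^{1/2}.  If 1 = G0 + E + F with positive summands, then the pair with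
   resolvents G0 and G0 + E satisfies (2) as soon as ran E^{1/2} and
   ran G0^{1/2} meet only in 0, it satisfies (3) as soon as ran E^{1/2} and
   ran F^{1/2} meet only in 0, and it satisfies (1) when ker E = ran (S + 1).

   Let G be the mean of the resolvents of two disjoint extensions of S, and let
   B and B' be the parts of G and 1 - G shorted to the defect space
   N = ran (S + 1)^perp.  Then ran (G - B)^{1/2} and ran (1 - G - B')^{1/2} meet
   N only in 0, and disjointness says that D = B + B' is injective on N.  Hence
   every decomposition D = D0 + E + D1 into positive summands such that E is
   injective on N and ran E^{1/2} meets ran D0^{1/2} and ran D1^{1/2} only in 0
   yields a pair with resolvents G - B + D0 and G - B + D0 + E.  One such
   decomposition is D0 = D1 = 0 (this is the Friedrichs-Krein pair).  When N is
   infinite-dimensional there is another one, obtained from two disjoint dense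
   operator ranges in N; as two distinct pairs cannot both be equal to
   {S_F, S_K}, the extensions S_F and S_K never have to be identified. *)
Require Import Defs.
From HB Require Import structures.
From mathcomp Require Import all_boot all_order all_algebra.
From mathcomp Require Import complex ring lra.
From mathcomp Require Import all_classical all_reals all_analysis.
Import Order.TTheory GRing.Theory Num.Theory numFieldNormedType.Exports.
Local Open Scope classical_set_scope.
Local Open Scope ring_scope.

Set Implicit Arguments.
Unset Strict Implicit.
Unset Printing Implicit Defensive.

(** Resolvents treat multivalued extensions like operators: ker G is mul T, and T_s acts in its
    orthogonal complement. There T_s^{1/2} is formally (1 - G)^{1/2} G^{-1/2}, so that with X =
    G^{1/2} the form is T[X a, X b] = (a, b) - (X a, X b). This turns (2) and (3) into statements
    about ranges of square roots. The obstacle is the second decomposition: E must stay injective on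
    N while ran E^{1/2} avoids the ranges of both other roots. It has the shape D0 = Q k p1 k Q, E =
    Q Z Q, D1 = Q k p2 k Q with Q = D^{1/2}, k = (1 - Z)^{1/2} and p1, p2 projections onto
    orthogonal subspaces of N. It remains to find an injective positive contraction Z, the identity
    off ran (p1 + p2), whose root has a range meeting ran p1 and ran p2 only in 0. For this Z has to
    mix the two subspaces: it is O^* O on their sum, and a vector O^* m in one of them makes m
    orthogonal to the image under O of the other, which is dense in the closure of ran O. *)

Section HilbertSpace.
Local Open Scope complex_scope.
Variables (R : realType) (H : completeNormedModType R[i]).
Variable ip : {dot H for Num.conj}.
Hypothesis norm_ip : forall x : H, `|x| ^+ 2 = ip x x.

(* Subspaces and operators being complex linear, orthogonality and symmetry can be
   tested on the real part of the inner product. *)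
Definition rp (x y : H) : R := complex.Re (ip x y).

(** * Inner product, norm and convergence *)

Lemma ipZl (a : R[i]) x y : ip (a *: x) y = a * ip x y.
Proof. exact: linearZl_LR. Qed.

Lemma ipZr (a : R[i]) x y : ip x (a *: y) = a^* * ip x y.
Proof. exact: linearZr_LR. Qed.

Lemma ipDl x y z : ip (x + y) z = ip x z + ip y z.
Proof. exact: linearDl. Qed.

Lemma ipDr x y z : ip z (x + y) = ip z x + ip z y.
Proof. exact: linearDr. Qed.

Lemma ipBl x y z : ip (x - y) z = ip x z - ip y z.
Proof. exact: linearBl. Qed.

Lemma ipBr x y z : ip z (x - y) = ip z x - ip z y.
Proof. exact: linearBr. Qed.

Lemma ReM (a b : R[i]) : complex.Re (a * b) =
  complex.Re a * complex.Re b - complex.Im a * complex.Im b.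
Proof. by case: a b => a b [c d]. Qed.

Lemma rpC x y : rp x y = rp y x.
Proof. by rewrite /rp hermC /= expr0 mul1r; case: (ip y x). Qed.

Lemma rpDl x y z : rp (x + y) z = rp x z + rp y z.
Proof. by rewrite /rp linearDl raddfD. Qed.

Lemma rpNl x z : rp (- x) z = - rp x z.
Proof. by rewrite /rp linearNl raddfN. Qed.

Lemma rpZl (a : R) x z : rp (a%:C *: x) z = a * rp x z.
Proof. by rewrite /rp ipZl ReM /= mul0r subr0. Qed.

Lemma rpDr x y z : rp z (x + y) = rp z x + rp z y.
Proof. by rewrite !(rpC z) rpDl. Qed.

Lemma rpNr x z : rp z (- x) = - rp z x.
Proof. by rewrite !(rpC z) rpNl. Qed.

Lemma rpZr (a : R) x z : rp z (a%:C *: x) = a * rp z x.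
Proof. by rewrite !(rpC z) rpZl. Qed.

Lemma rp0l x : rp 0 x = 0.
Proof. by rewrite /rp linear0l. Qed.

Lemma rp0r x : rp x 0 = 0.
Proof. by rewrite rpC rp0l. Qed.

Definition rpE := (rpDl, rpDr, rpNl, rpNr, rpZl, rpZr, rp0l, rp0r).

Lemma ip_rp x y : ip x y = rp x y +i* rp x ('i *: y).
Proof.
rewrite /rp ipZr ReM /=; case: (ip x y) => a b /=.
by rewrite mul0r sub0r mulN1r opprK.
Qed.

Lemma rp_i x y : rp ('i *: x) ('i *: y) = rp x y.
Proof.
rewrite /rp ipZl ipZr mulrA (_ : 'i * _ = 1) ?mul1r //.
by apply/eqP; rewrite eq_complex /=; apply/andP; split; apply/eqP; ring.
Qed.

Lemma rpxx_ge0 x : 0 <= rp x x.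
Proof.
have := exprn_ge0 2 (normr_ge0 x); rewrite norm_ip /rp.
by case: (ip x x) => a b; rewrite lecE => /andP[].
Qed.

Lemma ip_xx x : ip x x = (rp x x)%:C.
Proof.
have := exprn_ge0 2 (normr_ge0 x); rewrite norm_ip /rp.
by case: (ip x x) => a b; rewrite lecE /= => /andP[/eqP ->].
Qed.

(** The norm of [H] takes values in [R[i]], whose order is partial; estimates are made with this
    real version of it. *)
Definition nr x := Num.sqrt (rp x x).

Lemma nr_ge0 x : 0 <= nr x.
Proof. exact: sqrtr_ge0. Qed.

Lemma sqr_nr x : nr x ^+ 2 = rp x x.
Proof. by rewrite sqr_sqrtr ?rpxx_ge0. Qed.

Lemma norm_nr x : `|x| = (nr x)%:C.
Proof.
apply/eqP; rewrite -(eqrXn2 (n := 2)) ?normr_ge0 ?lecR ?nr_ge0 //.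
by rewrite norm_ip ip_xx -sqr_nr -rmorphXn.
Qed.

Lemma nr0 : nr 0 = 0.
Proof. by rewrite /nr rp0l sqrtr0. Qed.

Lemma nr_eq0 x : nr x = 0 -> x = 0.
Proof. by move=> x0; apply/normr0_eq0; rewrite norm_nr x0. Qed.

Lemma rp_eq0 x : rp x x = 0 -> x = 0.
Proof. by move=> x0; apply: nr_eq0; rewrite /nr x0 sqrtr0. Qed.

Lemma nrD x y : nr (x + y) <= nr x + nr y.
Proof. by have := ler_normD x y; rewrite !norm_nr -rmorphD lecR. Qed.

Lemma nrN x : nr (- x) = nr x.
Proof. by rewrite /nr rpNl rpNr opprK. Qed.

Lemma nrB x y : nr (x - y) = nr (y - x).
Proof. by rewrite -nrN opprB. Qed.

Lemma nr_dist x y z : nr (x - z) <= nr (x - y) + nr (y - z).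
Proof. by have := nrD (x - y) (y - z); rewrite addrA subrK. Qed.

Lemma nrZ (a : R[i]) x : nr (a *: x) = complex.Re `|a| * nr x.
Proof.
have := normrZ a x; rewrite !norm_nr => /(congr1 (@complex.Re R)) /= ->.
by rewrite mulr0 subr0.
Qed.

Lemma rp_sqr_le x y : rp x y ^+ 2 <= rp x x * rp y y.
Proof.
have [x0|x0] := eqVneq (rp x x) 0.
  by rewrite (rp_eq0 x0) !rp0l expr0n mul0r.
have xgt0 : 0 < rp x x by rewrite lt0r x0 rpxx_ge0.
have := rpxx_ge0 ((rp x x)%:C *: y - (rp x y)%:C *: x).
rewrite !rpE (rpC y x).
rewrite (_ : _ + _ = rp x x * (rp x x * rp y y - rp x y ^+ 2)); last by ring.
by rewrite pmulr_rge0 // subr_ge0.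
Qed.

Lemma rp_le x y : `|rp x y| <= nr x * nr y.
Proof.
rewrite -(@ler_pXn2r _ 2) ?nnegrE ?mulr_ge0 ?nr_ge0 // exprMn !sqr_nr.
by rewrite real_normK ?num_real // rp_sqr_le.
Qed.

Definition cvs (u : nat -> H) x := (fun n => nr (u n - x)) @ \oo --> (0 : R).

Lemma cvs_le (e : nat -> R) u x : e @ \oo --> 0 ->
  (forall n, nr (u n - x) <= e n) -> cvs u x.
Proof.
move=> e0 ue; apply: (@squeeze_cvgr _ _ _ _ (cst 0) e) => //; last exact: cvg_cst.
by apply: nearW => n; rewrite nr_ge0 ue.
Qed.

Lemma cvs_cst x : cvs (fun=> x) x.
Proof. by rewrite /cvs subrr nr0; exact: cvg_cst. Qed.

Lemma cvsD u v x y : cvs u x -> cvs v y -> cvs (fun n => u n + v n) (x + y).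
Proof.
move=> ux vy; apply: (@cvs_le (fun n => nr (u n - x) + nr (v n - y))).
  by rewrite -[0]addr0; exact: cvgD.
by move=> n; rewrite opprD addrACA nrD.
Qed.

Lemma cvs_bnd (A : {linear H -> H}) (c : R) u x :
  (forall h, nr (A h) <= c * nr h) -> cvs u x -> cvs (fun n => A (u n)) (A x).
Proof.
move=> Ac ux; apply: (@cvs_le (fun n => c * nr (u n - x))).
  by rewrite -[0](mulr0 c); apply: cvgM => //; exact: cvg_cst.
by move=> n; rewrite -linearB.
Qed.

Lemma cvsZ (a : R[i]) u x : cvs u x -> cvs (fun n => a *: u n) (a *: x).
Proof.
move=> ux; apply: (@cvs_le (fun n => complex.Re `|a| * nr (u n - x))).
  by rewrite -[0](mulr0 (complex.Re `|a|)); apply: cvgM => //; exact: cvg_cst.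
by move=> n; rewrite -scalerBr nrZ.
Qed.

Lemma cvsN u x : cvs u x -> cvs (fun n => - u n) (- x).
Proof. by move=> ux; apply: cvg_trans ux; under eq_fun do rewrite -opprD nrN. Qed.

Lemma cvsB u v x y : cvs u x -> cvs v y -> cvs (fun n => u n - v n) (x - y).
Proof. by move=> ux /cvsN vy; exact: cvsD. Qed.

Lemma cvs_rp u v x y : cvs u x -> cvs v y ->
  (fun n => rp (u n) (v n)) @ \oo --> rp x y.
Proof.
move=> ux vy.
have D0 : (fun n => nr (u n - x) * nr (v n - y) + nr (u n - x) * nr y
    + nr x * nr (v n - y)) @ \oo --> (0 : R).
  rewrite -[X in _ --> X](_ : 0 * 0 + 0 * nr y + nr x * 0 = 0); last by ring.
  apply: cvgD; last by apply: cvgM => //; exact: cvg_cst.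
  by apply: cvgD; apply: cvgM => //; exact: cvg_cst.
apply/cvgrPdist_le => eps e0.
move/cvgrPdist_le : D0 => /(_ _ e0); apply: filterS => n.
rewrite sub0r normrN => /(le_trans (ler_norm _)); apply: le_trans.
rewrite (_ : _ - _ = - (rp (u n - x) (v n - y) + rp (u n - x) y + rp x (v n - y))).
  rewrite normrN (le_trans (ler_normD _ _)) // lerD ?rp_le //.
  by rewrite (le_trans (ler_normD _ _)) // lerD ?rp_le.
by rewrite !rpE; ring.
Qed.

Lemma cvs_unique u x y : cvs u x -> cvs u y -> x = y.
Proof.
move=> ux uy; apply/subr0_eq/rp_eq0.
have := cvs_rp (cvsB ux uy) (cvsB ux uy).
under eq_fun do rewrite subrr rp0l.
by move=> /cvg_lim <- //; rewrite lim_cst.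
Qed.

(** The Cauchy bounds below come from comparing two terms with a common limit or infimum, hence a
    sum of two rates. *)
Lemma complete_rate (e : nat -> R) u : e @ \oo --> 0 ->
  (forall n m, nr (u n - u m) <= e n + e m) -> exists x, cvs u x.
Proof.
move=> e0 ue.
have : cauchy (u @ \oo).
  apply/cauchy_ballP => eps; rewrite ltcE /= => /andP[/eqP im0 re0]; near_simpl.
  have e2 : \forall n \near \oo, e n < complex.Re eps / 2.
    by apply: (cvgr_lt 0 e0); rewrite divr_gt0.
  near=> n m; rewrite -ball_normE /= norm_nr ltcE /= im0 eqxx /=.
  apply: (le_lt_trans (ue _ _)); rewrite [ltRHS]splitr.
  by apply: ltrD; [near: n|near: m]; exact: e2.
move=> /cauchy_cvgP/cvg_ex[x ux]; exists x; apply/cvgrPdist_lt => eps e1.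
have /cvgrPdist_lt /(_ eps%:C) := ux; rewrite ltcR => /(_ e1).
apply: filterS => n; rewrite norm_nr ltcR.
by rewrite sub0r normrN nrB ger0_norm // nr_ge0.
Unshelve. all: by end_near. Qed.

Lemma closure_nrP (A : set H) x :
  closure A x <-> forall eps : R, 0 < eps -> exists2 y, A y & nr (x - y) < eps.
Proof.
split=> [Ax eps e0|Ax B].
  have /Ax [y [Ay]] : nbhs x (ball x eps%:C).
    by apply: nbhsx_ballx; rewrite ltcR.
  rewrite -ball_normE /= norm_nr ltcR => xy; by exists y.
move=> /nbhs_ballP[eps] /=; rewrite ltcE /= => /andP[/eqP im0 re0] eB.
have [y Ay xy] := Ax _ re0.
exists y; split=> //; apply: eB.
rewrite -ball_normE /= norm_nr ltcE /=.
by rewrite im0 eqxx.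
Qed.

(** * Riesz representation, projections and adjoints *)

Definition subspace (D : set H) :=
  D 0 /\ forall (a : R[i]) x y, D x -> D y -> D (a *: x + y).

Lemma subspaceD D x y : subspace D -> D x -> D y -> D (x + y).
Proof. by move=> [_ sD] Dx Dy; rewrite -[x]scale1r; exact: sD. Qed.

Lemma subspaceZ D a x : subspace D -> D x -> D (a *: x).
Proof. by move=> [D0 sD] Dx; rewrite -[_ *: _]addr0; exact: sD. Qed.

Lemma subspaceB D x y : subspace D -> D x -> D y -> D (x - y).
Proof.
by move=> sD Dx Dy; apply: subspaceD => //; rewrite -scaleN1r; exact: subspaceZ.
Qed.

Lemma harmonic_to0 : (fun n => n.+1%:R^-1 : R) @ \oo --> 0.
Proof. exact: cvg_harmonic. Qed.

Lemma cvg_harmonic_eq (u : nat -> R) (x c y : R) : u @ \oo --> x ->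
  (forall n, `|u n - y| <= n.+1%:R^-1 * c) -> x = y.
Proof.
move=> ux uy.
have : u @ \oo --> y.
  apply/cvgrPdist_le => eps e0.
  have /cvgrPdist_le/(_ _ e0) : (fun n => n.+1%:R^-1 * c) @ \oo --> (0 : R).
    rewrite -[X in _ --> X](mul0r c); apply: cvgM; last exact: cvg_cst.
    exact: harmonic_to0.
  apply: filterS => n; rewrite sub0r normrN => /(le_trans (ler_norm _)).
  by apply: le_trans; rewrite distrC uy.
by move=> /cvg_lim <- //; rewrite (cvg_lim _ ux).
Qed.

Lemma ler_of_sqr (b s : R) : 0 <= s -> b ^+ 2 <= s ^+ 2 -> b <= s.
Proof.
by move=> s0 bs; rewrite leNgt; apply/negP => sb; nra.
Qed.

(* Minimising sequences of |W g|^2 - 2 l g over D have W g_n Cauchy. *)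
Lemma riesz (W : {linear H -> H}) (D : set H) (l : H -> R) (c : R) :
    subspace D ->
    (forall a x y, D x -> D y -> l (a%:C *: x + y) = a * l x + l y) ->
    0 <= c -> (forall h, D h -> l h ^+ 2 <= c * rp (W h) (W h)) ->
  exists g m, [/\ forall n, D (g n), cvs (fun n => W (g n)) m
    & forall h, D h -> l h = rp (W h) m].
Proof.
move=> sD lin_l c0 lc.
pose F g := rp (W g) (W g) - 2 * l g.
have Fge g : D g -> - c <= F g.
  move=> /lc Dg; rewrite /F.
  have ge0 := rpxx_ge0 (W g).
  suff : 2 * l g <= rp (W g) (W g) + c by lra.
  apply: ler_of_sqr; first by rewrite addr_ge0.
  by have := sqr_ge0 (rp (W g) (W g) - c); lra.
have hinf : has_inf (F @` D).
  split; first by exists (F 0), 0 => //; exact: sD.1.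
  by exists (- c) => _ [g Dg <-]; exact: Fge.
pose e n : R := n.+1%:R^-1.
have e_gt0 n : 0 < e n by rewrite invr_gt0.
have /choice[g gP] : forall n, exists g, D g /\ F g < inf (F @` D) + e n ^+ 2.
  move=> n; have [_ [g Dg <-] gi] := inf_adherent (exprn_gt0 2 (e_gt0 n)) hinf.
  by exists g.
have Dg n : D (g n) by case: (gP n).
have gh n h : D h -> `|rp (W h) (W (g n)) - l h| <= e n * nr (W h).
  move=> Dh; apply: ler_of_sqr; first by rewrite mulr_ge0 ?nr_ge0 // ltW.
  rewrite exprMn sqr_nr real_normK ?num_real //.
  set d := _ - l h; set a := rp (W h) (W h).
  have a_ge0 : 0 <= a by exact: rpxx_ge0.
  (* [g n] minimises [F] up to [e n ^+ 2]; compare it with the competitor g n + t h. The best t = -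
     d / a then gives d^2 <= e_n^2 a. *)
  have key t : 0 <= e n ^+ 2 + t ^+ 2 * a + 2 * t * d.
    have : inf (F @` D) <= F (t%:C *: h + g n).
      apply: ge_inf; first by case: hinf.
      by exists (t%:C *: h + g n) => //; apply: sD.2.
    move: (gP n).2; rewrite /F lin_l // linearP !rpE (rpC (W (g n)) (W h)) /d /a.
    move: (inf _) => I; lra.
  have [a0|a0] := eqVneq a 0.
    have Wh0 := rp_eq0 a0; rewrite /d Wh0 rp0l sub0r sqrrN a0 mulr0.
    by have := lc _ Dh; rewrite -/a a0 mulr0.
  have a_gt0 : 0 < a by rewrite lt0r a0.
  have := key (- d / a).
  rewrite (_ : _ + _ = e n ^+ 2 - d ^+ 2 / a); last by field.
  by rewrite subr_ge0 ler_pdivrMr.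
have [|m Wm] := @complete_rate e (fun n => W (g n)) harmonic_to0.
  move=> n k; rewrite -linearB; set h := g n - g k.
  have Dh : D h by exact: subspaceB.
  have [->|h0] := eqVneq (nr (W h)) 0; first by rewrite addr_ge0 ?ltW.
  have hgt0 : 0 < nr (W h) by rewrite lt0r h0 nr_ge0.
  rewrite -(ler_pM2r hgt0) -expr2 sqr_nr mulrDl.
  have -> : rp (W h) (W h) = (rp (W h) (W (g n)) - l h) - (rp (W h) (W (g k)) - l h).
    by rewrite {2}/h linearB !rpE; ring.
  by rewrite (le_trans (ler_norm _)) // (le_trans (ler_normB _ _)) // lerD ?gh.
exists g, m; split=> // h Dh; apply/esym.
apply: (@cvg_harmonic_eq (fun n => rp (W h) (W (g n))) _ (nr (W h))).
  by apply: cvs_rp => //; exact: cvs_cst.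
by move=> n; exact: gh.
Qed.

Lemma rp_inj x y : (forall h, rp x h = rp y h) -> x = y.
Proof. by move=> xy; apply/subr0_eq/rp_eq0; rewrite rpDl rpNl xy subrr. Qed.

Lemma rpZ_conj (a : R[i]) x y : rp x (a *: y) = rp (a^* *: x) y.
Proof. by rewrite /rp ipZl ipZr. Qed.

Lemma linear_ex (f : H -> H) :
  (forall a x y, f (a *: x + y) = a *: f x + f y) ->
  exists A : {linear H -> H}, forall x, A x = f x.
Proof.
move=> lf.
pose m := GRing.isLinear.Build R[i] H H *:%R f lf.
by exists (HB.pack_for {linear H -> H} f m).
Qed.

Definition seq_closed (D : set H) :=
  forall u x, (forall n, D (u n)) -> cvs u x -> D x.

Lemma seq_closed_orth (D : set H) :
  seq_closed [set x | forall d, D d -> rp x d = 0].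
Proof.
move=> u x uD ux d Dd.
have := cvs_rp ux (cvs_cst d); under eq_fun do rewrite uD //.
by move=> /cvg_lim <- //; rewrite lim_cst.
Qed.

Lemma subspace_orth (D : set H) : subspace D ->
  subspace [set x | forall d, D d -> rp x d = 0].
Proof.
move=> sD; split=> [d _|a x y xD yD d Dd] /=; first by rewrite rp0l.
rewrite rpDl yD // addr0 rpC rpZ_conj rpC.
rewrite xD //; exact: subspaceZ.
Qed.

Lemma projection (D : set H) : subspace D -> seq_closed D ->
  exists P : {linear H -> H},
    (forall x, D (P x)) /\ forall x d, D d -> rp (x - P x) d = 0.
Proof.
move=> sD cD.
have /choice[p pP] : forall x, exists m, D m /\ forall d, D d -> rp (x - m) d = 0.
  move=> x; have [|||g [m [Dg gm lm]]] := @riesz idfun D (rp x) (rp x x) sD.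
  - by move=> a y z _ _; rewrite !rpE.
  - exact: rpxx_ge0.
  - by move=> h _; exact: rp_sqr_le.
  exists m; split; first exact: cD gm.
  by move=> d Dd; rewrite rpDl rpNl lm // (rpC m) subrr.
have [|P PE] := @linear_ex p.
  move=> a x y; apply/subr0_eq/rp_eq0; set w := _ - _.
  have Dw : D w by apply: subspaceB => //; [exact: (pP _).1|apply: sD.2; exact: (pP _).1].
  have -> : rp w w = rp (a *: (x - p x) + (y - p y) - (a *: x + y - p (a *: x + y))) w.
    congr (rp _ w); rewrite /w scalerBr [X in _ = X - _]addrACA -opprD opprB.
    by rewrite [RHS]addrC [RHS]addrA subrK.
  rewrite rpDl rpNl (pP _).2 // subr0 rpDl (pP _).2 // addr0.
  rewrite rpC rpZ_conj rpC (pP _).2 //; exact: subspaceZ.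
exists P; split=> [x|x d Dd]; rewrite PE; first exact: (pP x).1.
exact: (pP x).2.
Qed.

Lemma adjoint_ex (A : {linear H -> H}) (c : R) : 0 <= c ->
  (forall h, nr (A h) <= c * nr h) ->
  exists B : {linear H -> H}, (forall x y, rp (A x) y = rp x (B y))
    /\ forall h, nr (B h) <= c * nr h.
Proof.
move=> c0 Ac.
have /choice[b bP] : forall y, exists m, forall x, rp (A x) y = rp x m.
  move=> y; have [||||g [m [_ _ lm]]] :=
    @riesz idfun setT (fun x => rp (A x) y) (c ^+ 2 * rp y y).
  - by [].
  - by move=> a x z _ _; rewrite linearP !rpE.
  - by rewrite mulr_ge0 ?exprn_ge0 ?rpxx_ge0.
  - move=> h _; apply: (le_trans (rp_sqr_le _ _)).
    rewrite mulrAC ler_wpM2r ?rpxx_ge0 // -!sqr_nr -exprMn.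
    by rewrite ler_pXn2r ?nnegrE ?mulr_ge0 ?nr_ge0.
  by exists m => x; rewrite lm.
have [|B BE] := @linear_ex b.
  move=> a x y; apply: rp_inj => h; rewrite rpC -bP rpDr rpZ_conj -linearZ !bP.
  by rewrite [RHS]rpC rpDr rpZ_conj.
have AB x y : rp (A x) y = rp x (B y) by rewrite BE bP.
exists B; split=> // h.
have [->|h0] := eqVneq (nr (B h)) 0; first by rewrite mulr_ge0 ?nr_ge0.
have hgt0 : 0 < nr (B h) by rewrite lt0r h0 nr_ge0.
rewrite -(ler_pM2l hgt0) -expr2 sqr_nr -AB (le_trans (ler_norm _)) //.
by rewrite (le_trans (rp_le _ _)) // mulrA ler_wpM2r ?nr_ge0 // mulrC.
Qed.

(** * Positive contractions and their square roots *)

Definition symop (A : {linear H -> H}) := forall x y, rp (A x) y = rp x (A y).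

Lemma symop_ip (A : {linear H -> H}) x y : symop A -> ip (A x) y = ip x (A y).
Proof. by move=> sA; rewrite !ip_rp !sA linearZ. Qed.

Definition posop (A : {linear H -> H}) := symop A /\ forall h, 0 <= rp (A h) h.

Definition pcop (A : {linear H -> H}) := posop A /\ forall h, rp (A h) h <= rp h h.

Lemma discriminant (a b c : R) : 0 <= a ->
  (forall t, 0 <= a * t ^+ 2 + 2 * b * t + c) -> b ^+ 2 <= a * c.
Proof.
move=> a0 q; have [a_eq0|a_neq0] := eqVneq a 0.
  have [->|b0] := eqVneq b 0; first by rewrite expr0n a_eq0 mul0r.
  have := q (- (c + 1) / (2 * b)); rewrite a_eq0 mul0r add0r.
  rewrite (_ : _ + _ = -1); last by field.
  by rewrite oppr_ge0 ler10.
have a_gt0 : 0 < a by rewrite lt0r a_neq0.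
have := q (- b / a); rewrite (_ : _ + _ = (a * c - b ^+ 2) / a); last by field.
by rewrite pmulr_lge0 ?invr_gt0 // subr_ge0.
Qed.

Lemma posop_schwarz A x y : posop A ->
  rp (A x) y ^+ 2 <= rp (A x) x * rp (A y) y.
Proof.
move=> [sA pA]; rewrite mulrC; apply: discriminant => // t.
have := pA (t%:C *: y + x); rewrite linearP !rpE (sA y x) (rpC y).
by congr (0 <= _); ring.
Qed.

Lemma posop_eq0 A x : posop A -> rp (A x) x = 0 -> A x = 0.
Proof.
move=> pA x0; apply/rp_eq0/eqP; rewrite -sqrf_eq0 eq_le sqr_ge0 andbT.
by have := posop_schwarz x (A x) pA; rewrite x0 mul0r.
Qed.

(** Schwarz for the form (A x, y) at h and A h: |A h|^4 <= (A h, h) (A A h, A h) <= (A h, h) |A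
    h|^2. *)
Lemma pcop_sqr A h : pcop A -> rp (A h) (A h) <= rp (A h) h.
Proof.
move=> [pA A1]; have := posop_schwarz h (A h) pA.
have := A1 (A h); have := pA.2 h; have := rpxx_ge0 (A h); have := pA.2 (A h).
set a := rp (A h) (A h); set b := rp (A h) h; set d := rp (A (A h)) (A h).
move=> d0 a0 b0 da ab; have [a_eq0|a_neq0] := eqVneq a 0; first by rewrite a_eq0.
have a_gt0 : 0 < a by rewrite lt0r a_neq0.
by nra.
Qed.

Lemma pcop_nr A h : pcop A -> nr (A h) <= 1 * nr h.
Proof.
move=> pA; rewrite mul1r; apply: ler_of_sqr; rewrite ?nr_ge0 // !sqr_nr.
by apply: le_trans (pA.2 h); exact: pcop_sqr.
Qed.

Lemma nrZr (a : R) x : nr (a%:C *: x) = `|a| * nr x.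
Proof. by rewrite /nr rpZl rpZr mulrA -expr2 sqrtrM ?sqr_ge0 // sqrtr_sqr. Qed.

(* With A = 1 - G, the iterates y_{n+1} = (A + y_n^2) / 2 are polynomials in A with
   nonnegative coefficients; they converge to 1 - G^{1/2}, the norm of
   y_{n+1} - y_n being bounded by the same iteration at A = 1. *)
Section SquareRoot.
Variable G : {linear H -> H}.
Hypothesis pcG : pcop G.

Fixpoint sqrt_iter (n : nat) (h : H) : H :=
  if n is n'.+1 then (2^-1)%:C *: (h - G h + sqrt_iter n' (sqrt_iter n' h)) else 0.

Fixpoint sqrt_bound (n : nat) : R :=
  if n is n'.+1 then 2^-1 * (1 + sqrt_bound n' ^+ 2) else 0.

Local Notation y := sqrt_iter.
Local Notation s := sqrt_bound.

Lemma sqrt_bound01 n : 0 <= s n <= 1.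
Proof.
elim: n => [|n /= /andP[s0 s1]]; first by rewrite lexx ler01.
by apply/andP; split; nra.
Qed.

Lemma sqrt_bound_nd : {homo s : n m / (n <= m)%N >-> n <= m}.
Proof.
apply: homo_leq => [//|? ? ?|n]; first exact: le_trans.
elim: n => [|n IH]; first by have /andP[] := sqrt_bound01 1.
have /andP[s0 _] := sqrt_bound01 n.
by rewrite /= ler_pM2l ?invr_gt0 // lerD2l ler_pXn2r ?nnegrE // (le_trans s0 IH).
Qed.

Lemma half_nr h : nr ((2^-1)%:C *: h) = 2^-1 * nr h.
Proof. by rewrite nrZr ger0_norm // invr_ge0. Qed.

Lemma linear_sqrt_iter n a u v : y n (a *: u + v) = a *: y n u + y n v.
Proof.
elim: n u v => [|n IH] u v /=; first by rewrite scaler0 addr0.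
rewrite !IH linearP opprD [a *: u + v + _]addrACA -scalerBr addrACA -scalerDr.
by rewrite [LHS]scalerDr !scalerA [_ * a]mulrC.
Qed.

Lemma sqrt_iterB n u v : y n (u - v) = y n u - y n v.
Proof. by rewrite addrC -scaleN1r linear_sqrt_iter scaleN1r addrC. Qed.

Lemma complement_nr h : nr (h - G h) <= nr h.
Proof.
apply: ler_of_sqr; rewrite ?nr_ge0 // !sqr_nr !rpE.
have := pcop_sqr h pcG; have := pcG.1.2 h; rewrite (rpC h).
by lra.
Qed.

Lemma sqrt_iter_nr n h : nr (y n h) <= s n * nr h.
Proof.
elim: n h => [|n IH] h /=; first by rewrite nr0 mul0r.
rewrite half_nr -mulrA ler_pM2l ?invr_gt0 // (le_trans (nrD _ _)) //.
rewrite mulrDl mul1r lerD ?complement_nr //.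
rewrite (le_trans (IH _)) // expr2 -mulrA ler_wpM2l //.
by have /andP[] := sqrt_bound01 n.
Qed.

(** The difference of squares is split as y_{n+1} (y_{n+1} - y_n) + (y_{n+1} - y_n) y_n, which
    requires no commutation; the scalars [s n] satisfy the same identity, so the bound
    propagates. *)
Lemma sqrt_iterS_nr n h : nr (y n.+1 h - y n h) <= (s n.+1 - s n) * nr h.
Proof.
elim: n h => [|n IH] h.
  by have := sqrt_iter_nr 1 h; rewrite /= !subr0.
have -> : y n.+2 h - y n.+1 h =
    (2^-1)%:C *: (y n.+1 (y n.+1 h - y n h) + (y n.+1 (y n h) - y n (y n h))).
  rewrite sqrt_iterB addrA subrK; set a := y n.+1 (y n.+1 h).
  rewrite -[y n.+2 h]/((2^-1)%:C *: (h - G h + a)).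
  rewrite -[y n.+1 h]/((2^-1)%:C *: (h - G h + y n (y n h))).
  by apply: rp_inj => k; rewrite !rpE; ring.
rewrite half_nr.
have -> : s n.+2 - s n.+1 = 2^-1 * (s n.+1 * (s n.+1 - s n) + (s n.+1 - s n) * s n).
  by rewrite /=; ring.
rewrite -mulrA ler_pM2l ?invr_gt0 // (le_trans (nrD _ _)) // mulrDl.
have /andP[s0 _] := sqrt_bound01 n.+1.
have s1 : 0 <= s n.+1 - s n by rewrite subr_ge0 sqrt_bound_nd.
apply: lerD.
  by rewrite (le_trans (sqrt_iter_nr _ _)) // -mulrA ler_wpM2l.
by rewrite (le_trans (IH _)) // -mulrA ler_wpM2l // sqrt_iter_nr.
Qed.

Lemma sqrt_iter_dist n m h : (n <= m)%N -> nr (y m h - y n h) <= (s m - s n) * nr h.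
Proof.
move=> /subnK <-; elim: (m - n)%N => [|k IH].
  by rewrite add0n !subrr nr0 mul0r.
rewrite addSn (le_trans (nr_dist _ (y (k + n)%N h) _)) //.
have -> : s (k + n).+1 - s n = (s (k + n).+1 - s (k + n)%N) + (s (k + n)%N - s n) by ring.
by rewrite mulrDl lerD // sqrt_iterS_nr.
Qed.

Lemma sqrt_iter_cvs h : exists x, cvs (fun n => y n h) x.
Proof.
have cs : cvgn s.
  apply: nondecreasing_is_cvgn sqrt_bound_nd _.
  by exists 1 => _ [n _ <-]; have /andP[] := sqrt_bound01 n.
have sl n : s n <= limn s by exact: (nondecreasing_cvgn_le sqrt_bound_nd).
apply: (@complete_rate (fun n => (limn s - s n) * nr h)).
  rewrite -[X in _ --> X](mul0r (nr h)); apply: cvgM; last exact: cvg_cst.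
  by rewrite -(subrr (limn s)); apply: cvgB => //; exact: cvg_cst.
have key n m : (n <= m)%N ->
    nr (y m h - y n h) <= (limn s - s n) * nr h + (limn s - s m) * nr h.
  move=> nm; rewrite (le_trans (sqrt_iter_dist _ nm)) // -mulrDl ler_wpM2r ?nr_ge0 //.
  by have := sl n; have := sl m; lra.
move=> n m; have [/key|/ltnW/key] := leqP n m; first by rewrite nrB.
by rewrite [leRHS]addrC.
Qed.

Lemma sqrt_iter_sym n u v : rp (y n u) v = rp u (y n v).
Proof.
elim: n u v => [|n IH] u v /=; first by rewrite rp0l rp0r.
by rewrite !rpE !IH pcG.1.1.
Qed.

Lemma sqrt_iter_comm (B : {linear H -> H}) n h :
  (forall x, B (G x) = G (B x)) -> B (y n h) = y n (B h).
Proof.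
move=> BG; elim: n h => [|n IH] h /=; first by rewrite linear0.
by rewrite linearZ linearD linearB /= BG !IH.
Qed.

End SquareRoot.

(** The limit S of the iterates satisfies 2 S = (1 - G) + S^2, so (1 - S)^2 = G. The commutation
    clause, inherited from the iterates, yields commuting roots of G and 1 - G and the positivity of
    products. *)
Lemma sqrtop (G : {linear H -> H}) : pcop G ->
  exists X : {linear H -> H}, [/\ pcop X, forall h, X (X h) = G h
    & forall (B : {linear H -> H}) c, (forall h, nr (B h) <= c * nr h) ->
        (forall h, B (G h) = G (B h)) -> forall h, B (X h) = X (B h)].
Proof.
move=> pG; have /choice[S0 S0P] := sqrt_iter_cvs pG.
have [|S SE] := @linear_ex S0.
  move=> a u v; apply: (cvs_unique (S0P _)).
  under [X in cvs X]eq_fun do rewrite linear_sqrt_iter.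
  by apply: cvsD => //; exact: cvsZ.
have SP h : cvs (fun n => sqrt_iter G n h) (S h) by rewrite SE.
have S1 h : nr (S h) <= nr h.
  apply: ler_of_sqr; rewrite ?nr_ge0 // !sqr_nr.
  apply: (cvgr_to_le (cvs_rp (SP h) (SP h))); apply: nearW => n.
  rewrite -!sqr_nr ler_pXn2r ?nnegrE ?nr_ge0 // (le_trans (sqrt_iter_nr pG _ _)) //.
  by have /andP[_ s1] := sqrt_bound01 n; rewrite ler_piMl ?nr_ge0.
have SS h : S (S h) = S h + S h - (h - G h).
  have SyS : cvs (fun n => sqrt_iter G n (sqrt_iter G n h)) (S (S h)).
    have e0 : (fun n => nr (sqrt_iter G n h - S h) + nr (sqrt_iter G n (S h) - S (S h)))
        @ \oo --> (0 : R).
      by rewrite -[X in _ --> X]addr0; apply: cvgD; exact: SP.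
    apply: (cvs_le e0) => n; apply: (le_trans (nr_dist _ (sqrt_iter G n (S h)) _)).
    rewrite lerD2r -sqrt_iterB (le_trans (sqrt_iter_nr pG _ _)) //.
    by have /andP[_ s1] := sqrt_bound01 n; rewrite ler_piMl ?nr_ge0.
  have SpS : cvs (fun n => sqrt_iter G n.+1 h) (S h).
    by have := SP h; rewrite /cvs -(cvg_shiftS (fun n => nr (sqrt_iter G n h - S h))).
  have := cvs_unique SpS (cvsZ (2^-1)%:C (cvsD (cvs_cst (h - G h)) SyS)).
  move=> E; apply: rp_inj => k; have := congr1 (rp^~ k) E.
  by rewrite !rpE; lra.
have symS : symop S.
  move=> u v; have A := cvs_rp (SP u) (cvs_cst v).
  have := cvs_rp (cvs_cst u) (SP v).
  under eq_fun do rewrite -(sqrt_iter_sym pG).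
  by move=> /cvg_lim <- //; move/cvg_lim : A => <-.
have [|X XE] := @linear_ex (fun h => h - S h).
  by move=> a u v; rewrite linearP opprD addrACA -scalerBr.
have XX h : X (X h) = G h.
  by rewrite !XE linearB SS; apply: rp_inj => k; rewrite !rpE; ring.
have rpS h : `|rp (S h) h| <= rp h h.
  by rewrite (le_trans (rp_le _ _)) // -sqr_nr expr2 ler_wpM2r ?nr_ge0.
have symX : symop X by move=> u v; rewrite !XE !rpE symS.
exists X; split => //.
  split; first split=> // h.
    by rewrite XE !rpE subr_ge0 (le_trans (ler_norm _)).
  move=> h; rewrite (le_trans (ler_norm _)) // (le_trans (rp_le _ _)) //.
  rewrite -[leRHS]sqr_nr expr2 ler_wpM2r ?nr_ge0 //.
  apply: ler_of_sqr; rewrite ?nr_ge0 // !sqr_nr symX XX rpC.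
  exact: pG.2.
move=> B c Bc BG h; rewrite !XE linearB; congr (_ - _).
apply: (cvs_unique (cvs_bnd Bc (SP h))).
under [X in cvs X]eq_fun do rewrite (sqrt_iter_comm _ _ BG).
exact: SP.
Qed.

(** With Z = X^{1/2}, which also commutes with Y, the value is (Y Z h, Z h). *)
Lemma pcop_commute_ge0 (X Y : {linear H -> H}) h : pcop X -> pcop Y ->
  (forall h, X (Y h) = Y (X h)) -> 0 <= rp (X (Y h)) h.
Proof.
move=> pX pY XY; have [Z [pZ ZZ comZ]] := sqrtop pX.
have YZ k : Y (Z k) = Z (Y k) by apply: (comZ Y 1) => // ?; exact: pcop_nr.
by rewrite -ZZ -YZ pZ.1.1; exact: pY.1.2.
Qed.

Lemma sqrtop_pair (G : {linear H -> H}) : pcop G ->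
  exists X Y : {linear H -> H}, [/\ pcop X, pcop Y, forall h, X (X h) = G h,
    forall h, Y (Y h) = h - G h & forall h, X (Y h) = Y (X h)].
Proof.
move=> pG.
have [|G' GE] := @linear_ex (fun h => h - G h).
  by move=> a u v; rewrite linearP opprD addrACA -scalerBr.
have pG' : pcop G'.
  split; first split=> [u v|h].
  - by rewrite !GE !rpE pG.1.1.
  - by rewrite GE !rpE subr_ge0 pG.2.
  by move=> h; rewrite GE !rpE lerBlDr lerDl; exact: pG.1.2.
have [X [pX XX comX]] := sqrtop pG; have [Y [pY YY comY]] := sqrtop pG'.
exists X, Y; split=> // [h|h]; first by rewrite YY GE.
apply: (comY X 1) => [k|k]; first exact: pcop_nr.
by rewrite !GE linearB -!XX.
Qed.

(** * Selfadjoint relations and resolvents *)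

(** By [ip_rp] this says that [ip (A h) h] is real. *)
Lemma symop_i0 (A : {linear H -> H}) h : symop A -> rp (A h) ('i *: h) = 0.
Proof.
move=> sA; have := sA h ('i *: h); rewrite linearZ (rpC h) => E.
have : rp ('i *: A h) h = - rp (A h) ('i *: h).
  rewrite -[h in LHS]scale1r -[in LHS](rp_i) scalerA scale1r.
  by rewrite mulCii scaleN1r rpNl.
by move: E; lra.
Qed.

(* The relation T with (T + 1)^{-1} = G. *)
Definition rel (G : {linear H -> H}) : set (H * H) :=
  [set p | p.1 = G (p.1 + p.2)].

Lemma rel_image G h : rel G (G h, h - G h).
Proof. by rewrite /rel /= addrC subrK. Qed.

Lemma rp_re (x y x' y' : H) : ip x y = ip x' y' -> rp x y = rp x' y'.
Proof. by rewrite /rp => ->. Qed.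

Lemma rel_selfadjoint G : pcop G -> selfadjoint ip (rel G).
Proof.
move=> pG; apply/seteqP; split=> [q Gq|q [_ _ adj]].
  split=> // p Gp; have sG := pG.1.1.
  have E : ip p.1 (q.1 + q.2) = ip (p.1 + p.2) q.1.
    by rewrite {1}(Gp : p.1 = _) [in RHS](Gq : q.1 = _) symop_ip.
  by move: E; rewrite ipDl ipDr => /addrI.
suff : q.1 = G (q.1 + q.2) by [].
apply: rp_inj => h; have := rp_re (adj _ (rel_image G h)).
by rewrite pG.1.1 /= !rpE !(rpC _ h) !(rpC _ (G h)); lra.
Qed.

Lemma rel_nonnegative G : pcop G -> nonnegative ip (rel G).
Proof.
move=> pG p Gp.
have E : p.2 = (p.1 + p.2) - p.1 by rewrite addrC addKr.
rewrite E {2 3}(Gp : p.1 = _); set h := p.1 + p.2.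
have -> : ip (h - G h) (G h) = (rp (G h) h - rp (G h) (G h))%:C.
  rewrite -scaleN1r ipDl ipZl mulN1r ip_xx -symop_ip; last exact: pG.1.1.
  by rewrite ip_rp symop_i0 ?rmorphB //; exact: pG.1.1.
by rewrite ler0c subr_ge0 pcop_sqr.
Qed.

Section AdjointIn.
Variables (K : set H) (T : set (H * H)).
Hypothesis sT : selfadjoint_in ip K T.

Lemma sa_rp p q : T p -> T q -> rp p.2 q.1 = rp p.1 q.2.
Proof. by move=> Tp; rewrite {1}sT => -[_ _ /(_ _ Tp)/rp_re]. Qed.

Lemma sa_sub p : T p -> K p.1 /\ K p.2.
Proof. by rewrite {1}sT => -[]. Qed.

Lemma sa_linear a p q : subspace K -> T p -> T q -> T (a *: p + q).
Proof.
move=> sK Tp Tq; have [] := sa_sub Tp; have [] := sa_sub Tq => q1 q2 p1 p2.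
rewrite sT; split => [||r Tr]; [exact: sK.2|exact: sK.2|].
move: Tp Tq; rewrite {1 2}sT => -[_ _ /(_ _ Tr) e1] [_ _ /(_ _ Tr) e2].
by rewrite /= !ipDr !ipZr e1 e2.
Qed.

(** Real parts suffice: [T] is stable under multiplication by -i, which recovers the imaginary
    parts. *)
Lemma sa_maximal q : subspace K -> K q.1 -> K q.2 ->
  (forall p, T p -> rp p.2 q.1 = rp p.1 q.2) -> T q.
Proof.
move=> sK q1 q2 adj; rewrite sT; split => // p Tp.
rewrite !ip_rp adj //; congr (_ +i* _); rewrite !rpZ_conj.
have Tp' : T ('i^* *: p).
  rewrite -[_ *: p]addr0; apply: sa_linear => //.
  rewrite sT; split=> [||r _]; [exact: sK.1|exact: sK.1|].
  by rewrite !linear0r.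
exact: (adj _ Tp').
Qed.

Lemma sa_closed u v x y : subspace K -> seq_closed K ->
  (forall n, T (u n, v n)) -> cvs u x -> cvs v y -> T (x, y).
Proof.
move=> sK cK Tuv ux vy; apply: sa_maximal => //=.
- by apply: cK ux => n; case: (sa_sub (Tuv n)).
- by apply: cK vy => n; case: (sa_sub (Tuv n)).
move=> p Tp.
have := cvs_rp (cvs_cst p.1) vy; have := cvs_rp (cvs_cst p.2) ux.
under eq_fun do rewrite (sa_rp Tp (Tuv _)) /=.
by move=> /cvg_lim <- // /cvg_lim <-.
Qed.

End AdjointIn.

Lemma subspace_setT : subspace setT. Proof. by []. Qed.
Lemma seq_closed_setT : seq_closed setT. Proof. by []. Qed.

(** Nonnegativity makes p |-> p.1 + p.2 bounded below on T, so ran (T + 1) is closed. If y is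
    orthogonal to it, maximality puts (y, - y) in T, whence - |y|^2 >= 0 and y = 0. Every h is
    therefore p.1 + p.2 for exactly one p in T, and G h is p.1. *)
Lemma resolvent (T : set (H * H)) : selfadjoint ip T -> nonnegative ip T ->
  exists2 G : {linear H -> H}, pcop G & T = rel G.
Proof.
move=> saT nnT.
have pos p : T p -> 0 <= rp p.2 p.1.
  by move=> /nnT; rewrite ip_rp lecE /= => /andP[].
have lin a p q : T p -> T q -> T (a *: p + q).
  by apply: (sa_linear saT); exact: subspace_setT.
have T0 : T 0.
  by apply: (sa_maximal saT) => // p _; rewrite !rp0r.
have sub p q : T p -> T q -> T (p - q).
  by move=> Tp Tq; rewrite addrC -scaleN1r; exact: lin.
have norm1 p : T p -> nr p.1 <= nr (p.1 + p.2) /\ nr p.2 <= nr (p.1 + p.2).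
  move=> /pos p0; split; apply: ler_of_sqr; rewrite ?nr_ge0 // !sqr_nr !rpE;
  by have := rpxx_ge0 p.1; have := rpxx_ge0 p.2; rewrite (rpC p.1 p.2); lra.
pose D := [set h | exists2 p, T p & p.1 + p.2 = h].
have sD : subspace D.
  split; first by exists 0 => //; rewrite addr0.
  move=> a _ _ [p Tp <-] [q Tq <-]; exists (a *: p + q); first exact: lin.
  by rewrite /= scalerDr addrACA.
have cD : seq_closed D.
  move=> u x uD ux.
  have /choice[f fP] : forall n, exists p, T p /\ p.1 + p.2 = u n.
    by move=> n; have [p] := uD n; exists p.
  have fu n : (f n).1 + (f n).2 = u n by case: (fP n).
  have uu n m : nr (u n - u m) <= nr (u n - x) + nr (u m - x).
    by rewrite (nrB (u m)) nr_dist.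
  have ff n m : T (f n - f m) by apply: sub; case: (fP n); case: (fP m).
  have E n m : (f n - f m).1 + (f n - f m).2 = u n - u m.
    by rewrite /= addrACA fu -opprD fu.
  have [||y1 f1] := @complete_rate (fun n => nr (u n - x)) (fun n => (f n).1).
  - exact: ux.
  - move=> n m; apply: le_trans (uu _ _); rewrite -E.
    exact: (norm1 _ (ff n m)).1.
  have [||y2 f2] := @complete_rate (fun n => nr (u n - x)) (fun n => (f n).2).
  - exact: ux.
  - move=> n m; apply: le_trans (uu _ _); rewrite -E.
    exact: (norm1 _ (ff n m)).2.
  exists (y1, y2).
    apply: (sa_closed saT subspace_setT seq_closed_setT _ f1 f2) => n.
    by rewrite -surjective_pairing; case: (fP n).
  apply: (cvs_unique _ ux); have := cvsD f1 f2.
  by under [X in cvs X]eq_fun do rewrite fu.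
have [P [DP Porth]] := projection sD cD.
have full h : D h.
  have yT : T (h - P h, - (h - P h)).
    apply: (sa_maximal saT) => // p Tp /=; rewrite rpNr.
    have := Porth h (p.1 + p.2); rewrite rpDr rpC (rpC _ p.2) => E.
    by apply/eqP; rewrite -addr_eq0 addrC E //; exists p.
  have := pos _ yT; rewrite /= rpNl oppr_ge0 => le0.
  have /rp_eq0/subr0_eq -> : rp (h - P h) (h - P h) = 0.
    by apply/eqP; rewrite eq_le le0 rpxx_ge0.
  exact: DP.
have /choice[f fP] : forall h, exists p, T p /\ p.1 + p.2 = h.
  by move=> h; have [p] := full h; exists p.
have fE p : T p -> f (p.1 + p.2) = p.
  move=> Tp; have [Tf fs] := fP (p.1 + p.2).
  have [] := norm1 _ (sub _ _ Tf Tp); set q := f _ - p.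
  have -> : q.1 + q.2 = 0 by rewrite /= addrACA fs -opprD subrr.
  rewrite nr0 => q1 q2; apply/subr0_eq; rewrite -/q [q]surjective_pairing.
  by congr pair; apply/nr_eq0/eqP; rewrite eq_le nr_ge0 ?q1 ?q2.
have [|G GE] := @linear_ex (fun h => (f h).1).
  move=> a u v; have [Tu su] := fP u; have [Tv sv] := fP v.
  have := fE _ (lin a _ _ Tu Tv); rewrite /= addrACA -scalerDr su sv => ->.
  by [].
exists G; first split; first split.
- move=> h k; rewrite !GE; have [Th Eh] := fP k; have [Tk Ek] := fP h.
  rewrite -{1}Eh -{2}Ek; by rewrite rpDl rpDr (sa_rp saT Tk Th).
- move=> h; rewrite GE; have [Th E] := fP h; rewrite -{2}E.
  by rewrite rpDr addr_ge0 ?rpxx_ge0 // rpC; exact: pos.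
- move=> h; rewrite GE; have [Th E] := fP h; rewrite -{2 3 4}E.
  rewrite [leRHS]rpDl lerDl rpDr addr_ge0 ?rpxx_ge0 //; exact: pos.
apply/seteqP; split => p.
  by move=> Tp; rewrite /rel /= GE fE.
rewrite /rel /= GE => E; have [Tf fs] := fP (p.1 + p.2).
suff -> : p = f (p.1 + p.2) by [].
rewrite [RHS]surjective_pairing [LHS]surjective_pairing -E; congr pair.
by apply: (@addrI _ p.1); rewrite -[LHS]fs -E.
Qed.

(** * The form of a nonnegative selfadjoint relation *)

(** Since ker G is the multivalued part of [rel G], this is the space in which its operator part
    acts ([closure_dom_rel]). *)
Definition orthker (G : {linear H -> H}) : set H :=
  [set x | forall k, G k = 0 -> rp x k = 0].

Lemma linZ (A : {linear H -> H}) a x : A (a *: x) = a *: A x.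
Proof. exact: linearZ_LR. Qed.

Lemma subspace_orthker G : subspace (orthker G).
Proof.
apply: subspace_orth; split=> [|a x y Gx Gy]; rewrite ?linear0 //.
by rewrite linearP Gx Gy scaler0 addr0.
Qed.

Lemma seq_closed_orthker G : seq_closed (orthker G).
Proof. exact: seq_closed_orth. Qed.

Lemma orthker_eq0 G x : orthker G x -> G x = 0 -> x = 0.
Proof. by move=> Gx /Gx /rp_eq0. Qed.

Lemma orthker_symop G h : symop G -> orthker G (G h).
Proof. by move=> sG k Gk; rewrite sG Gk rp0r. Qed.

Lemma orthker_ip G x k : orthker G x -> G k = 0 -> ip x k = 0.
Proof.
move=> Gx Gk; have Gik : G ('i *: k) = 0 by rewrite linZ Gk scaler0.
by rewrite ip_rp !Gx.
Qed.

Lemma closure_cvsP (D : set H) x :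
  closure D x <-> exists2 u, forall n, D (u n) & cvs u x.
Proof.
split=> [/closure_nrP Dx|[u Du ux]].
  have /choice[u uP] : forall n : nat, exists y, D y /\ nr (x - y) < n.+1%:R^-1.
    by move=> n; have [|y Dy xy] := Dx n.+1%:R^-1; [rewrite invr_gt0|exists y].
  exists u => [n|]; first by case: (uP n).
  by apply: (cvs_le harmonic_to0) => n; rewrite nrB ltW //; case: (uP n).
apply/closure_nrP => eps e0.
have /cvgrPdist_lt/(_ _ e0)[n _ /(_ n (leqnn n))] := ux.
by rewrite /= sub0r normrN ger0_norm ?nr_ge0 // nrB => un; exists (u n).
Qed.

Lemma subspace_closure (D : set H) : subspace D -> subspace (closure D).
Proof.
move=> sD; split; first by apply: subset_closure; exact: sD.1.
move=> a x y /closure_cvsP[u Du ux] /closure_cvsP[v Dv vy].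
apply/closure_cvsP; exists (fun n => a *: u n + v n) => [n|]; first exact: sD.2.
by apply: cvsD => //; exact: cvsZ.
Qed.

Lemma seq_closed_closure (D : set H) : seq_closed (closure D).
Proof.
move=> u x Du ux; apply: closed_closure; apply/closure_cvsP.
by exists u.
Qed.

Lemma closure_dom_rel G : symop G -> closure ((rel G).`1) = orthker G.
Proof.
move=> sG; set D := _.`1.
have DP x : D x <-> exists h, x = G h.
  split=> [[y /= Gxy]|[h ->]]; first by exists (x + y).
  by exists (h - G h); exact: rel_image.
have sD : subspace D.
  split; first by apply/DP; exists 0; rewrite linear0.
  by move=> a x y /DP[h ->] /DP[k ->]; apply/DP; exists (a *: h + k); rewrite linearP.
apply/seteqP; split=> x.
  move=> /closure_cvsP[u Du ux].
  apply: (seq_closed_orthker _ ux) => n.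
  have /DP[h ->] := Du n; exact: orthker_symop.
move=> Gx; have [P [PK Porth]] :=
  projection (subspace_closure sD) (@seq_closed_closure D).
have GxP : G (x - P x) = 0.
  apply: rp_inj => h; rewrite rp0l sG Porth //.
  by apply: subset_closure; apply/DP; exists h.
suff -> : x = P x by [].
by apply/subr0_eq/rp_eq0; rewrite rpDr rpNr (Porth x (P x)) // subr0 rpC Gx.
Qed.

(* u is in ran A^{1/2} (Douglas' lemma). *)
Definition oran (A : {linear H -> H}) (u : H) :=
  exists2 c : R, 0 <= c & forall h, rp u h ^+ 2 <= c * rp (A h) h.

Section ClosedForm.
Variables G X Y : {linear H -> H}.
Hypotheses (pG : pcop G) (pX : pcop X) (pY : pcop Y).
Hypotheses (XX : forall h, X (X h) = G h) (YY : forall h, Y (Y h) = h - G h).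
Hypothesis (XY : forall h, X (Y h) = Y (X h)).

Lemma kerX h : G h = 0 <-> X h = 0.
Proof.
split=> [Gh|Xh]; last by rewrite -XX Xh linear0.
by apply: rp_eq0; rewrite pX.1.1 XX Gh rp0r.
Qed.

Lemma rpXX h k : rp (X h) (X k) = rp (G h) k.
Proof. by rewrite pX.1.1 XX pG.1.1. Qed.

Lemma GY h : G (Y h) = Y (G h).
Proof. by rewrite -!XX !XY. Qed.

Lemma orthkerX h : orthker G (X h).
Proof. by move=> k /kerX Xk; rewrite pX.1.1 Xk rp0r. Qed.

Lemma sqrt_orthker_projection (P : {linear H -> H}) h :
    (forall x d, orthker G d -> rp (x - P x) d = 0) ->
  X (P h) = X h /\ G (P h) = G h.
Proof.
move=> Porth.
have GP : G (h - P h) = 0.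
  apply/rp_inj => k; rewrite rp0l pG.1.1; apply: Porth.
  exact: orthker_symop pG.1.1.
have /kerX := GP; rewrite linearB => /subr0_eq ->.
by move: GP; rewrite linearB => /subr0_eq ->.
Qed.

(** X has dense range in [orthker G], so what is known for vectors X h extends to the whole space by
    continuity. *)
Lemma orthker_approx a : orthker G a ->
  exists2 h, forall n, orthker G (h n) & cvs (fun n => X (h n)) a.
Proof.
move=> Ga.
have [||||g [m [_ gm lm]]] := @riesz X setT (fun h => rp (X h) a) (rp a a).
- exact: subspace_setT.
- by move=> t x y _ _; rewrite linearP !rpE.
- exact: rpxx_ge0.
- by move=> h _; rewrite mulrC rp_sqr_le.
have ma : m = a.
  have Km : orthker G m.
    apply: (seq_closed_orthker _ gm) => n; exact: orthkerX.
  apply/subr0_eq/(@orthker_eq0 G).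
    by apply: (subspaceB (@subspace_orthker G)).
  apply/kerX; apply: rp_inj => h.
  by rewrite rp0l pX.1.1 rpC rpDr rpNr lm // subrr.
have [P [PK Porth]] := projection (@subspace_orthker G) (@seq_closed_orthker G).
have XP h : X (P h) = X h by case: (sqrt_orthker_projection h Porth).
exists (P \o g) => [n|]; first exact: PK.
by under [X in cvs X]eq_fun do rewrite /= XP; rewrite -ma.
Qed.

Lemma oran_sqrt a : oran G (X a).
Proof.
exists (rp a a); first exact: rpxx_ge0.
by move=> h; rewrite pX.1.1 -rpXX rp_sqr_le.
Qed.

(** [riesz] with W = X writes (u, h) as (X h, m), where m is a limit of vectors X g_n and hence lies
    in [orthker G]. *)
Lemma sqrt_of_oran u : oran G u -> exists2 a, orthker G a & u = X a.
Proof.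
move=> [c c0 uc].
have [|||g [m [_ gm lm]]] := @riesz X setT (rp u) c _ _ c0.
- exact: subspace_setT.
- by move=> t x y _ _; rewrite !rpE.
- by move=> h _; rewrite rpXX.
exists m; last by apply: rp_inj => h; rewrite lm // pX.1.1 rpC.
by apply: (seq_closed_orthker _ gm) => n; exact: orthkerX.
Qed.

Lemma orthkerY h : orthker G h -> orthker G (Y h).
Proof. by move=> Gh k Gk; rewrite pY.1.1 Gh // GY Gk linear0. Qed.

(** Formally T_s = (1 - G) G^{-1}, with root Y X^{-1}; h is kept orthogonal to ker G so that the
    graph is single-valued. This guarantees that the choice in [sqrt_op_part] has a candidate. *)
Lemma sqrt_rel : is_sqrt_in ip (orthker G) (op_part ip (rel G))
  [set p | exists h, orthker G h /\ p = (X h, Y h)].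
Proof.
split.
- apply/seteqP; split=> [_ [h [Gh ->]]|q [Kq1 Kq2 adj]].
    split; [exact: orthkerX|exact: orthkerY|].
    move=> _ [k [Gk ->]] /=; rewrite symop_ip; last exact: pY.1.1.
    by rewrite symop_ip ?XY; last exact: pX.1.1.
  have YXq : Y q.1 = X q.2.
    apply/subr0_eq; set w := _ - _.
    have Kw : orthker G w.
      apply: (subspaceB (@subspace_orthker G)); [exact: orthkerY|exact: orthkerX].
    apply: rp_eq0; rewrite {2}/w rpDr rpNr -pY.1.1 -pX.1.1.
    have /adj/rp_re/= -> : exists h, orthker G h /\ (X w, Y w) = (X h, Y h).
      by exists w.
    by rewrite subrr.
  (* As Y q.1 = X q.2, applying X gives (X^2 + Y^2) q.1 = q.1, and applying Y gives q.2. *)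
  exists (X q.1 + Y q.2); split.
    apply: (subspaceD (@subspace_orthker G)); [exact: orthkerX|exact: orthkerY].
  rewrite [LHS]surjective_pairing !linearD XX XY -YXq YY -XY YXq XX YY.
  by congr pair; apply: rp_inj => k; rewrite !rpE; ring.
- move=> _ [h [Gh ->]] /=.
  have -> : ip (Y h) (X h) = (rp (X (Y h)) h)%:C.
    rewrite -symop_ip; last exact: pX.1.1.
    rewrite ip_rp; congr (_ +i* _).
    pose A := (X \o Y : {linear H -> H}).
    by apply: (@symop_i0 A) => u v; rewrite /A /= pX.1.1 pY.1.1 XY.
  by rewrite ler0c pcop_commute_ge0.
- apply/seteqP; split=> [v [h [Gh [/esym/kerX Xh ->]]]|_ ->].
    by rewrite /= (orthker_eq0 Gh Xh) linear0.
  by exists 0; rewrite !linear0; split=> //; exact: (subspace_orthker G).1.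
- have mulP k : Defs.mul (rel G) k <-> G k = 0.
    by rewrite /Defs.mul /rel /= add0r; split=> [<-|].
  apply/seteqP; split=> [[u v] [z [h [Gh [-> ->]]] [k [Gk [YX ->]]]]|[u v] [/= Guv orth]].
    have E : G (X h + Y k) = X h.
      rewrite -XX; congr (X _); rewrite linearD XX XY -YX YY.
      by apply: rp_inj => w; rewrite !rpE; ring.
    split=> [|w /mulP Gw /=]; first by rewrite /rel /= E.
    by apply: orthker_ip Gw; exact: orthkerY.
  have Kuv : orthker G (u + v).
    move=> k Gk; rewrite rpDl {1}(Guv : u = G (u + v)) (orthker_symop _ pG.1.1) // add0r.
    by rewrite /rp orth //; apply/mulP.
  (* Here u = G (u + v) and v = (1 - G) (u + v), so the midpoint of X^2 |-> Y X |-> Y^2 is Y X (u +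
     v). *)
  exists (Y (X (u + v))).
    by exists (X (u + v)); split; rewrite ?XX -?Guv //; exact: orthkerX.
  exists (Y (u + v)); split; first exact: orthkerY.
  by rewrite XY YY -Guv (addrC u) addrK.
Qed.

(* closed_form picks some square root of op_part, so that its form has to be computed
   for an arbitrary one. *)
Section AnySquareRoot.
Variable B : set (H * H).
Hypothesis sqB : is_sqrt_in ip (orthker G) (op_part ip (rel G)) B.

Lemma sqB_functional x y y' : B (x, y) -> B (x, y') -> y = y'.
Proof.
have [saB _ opB _] := sqB; move=> Bxy Bxy'; apply/subr0_eq.
have : Defs.mul B (y - y').
  rewrite /Defs.mul /= -(subrr x) -[(_, _)]/((x, y) - (x, y')) addrC -scaleN1r.
  by apply: (sa_linear saB) => //; exact: subspace_orthker.
by rewrite opB.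
Qed.

Lemma sqB_image h : orthker G h -> exists2 z, B (G h, z) & B (z, h - G h).
Proof.
have [_ _ _ BB] := sqB; move=> Gh.
have : (B \; B)%relation (G h, h - G h).
  rewrite BB; split; first exact: rel_image.
  move=> k; rewrite /Defs.mul /rel /= add0r => /esym Gk; apply: orthker_ip Gk.
  apply: (subspaceB (@subspace_orthker G)) => //.
  exact: orthker_symop pG.1.1.
by move=> [z]; exists z.
Qed.

(** Symmetry of [B] turns (z, w) into (h - G h, G k). On ran G the graph inner product of any root
    is thus that of the vectors X h, which is what makes the form independent of the chosen root. *)
Lemma sqB_form h k z w : B (G h, z) -> B (z, h - G h) -> B (G k, w) ->
  rp z w + rp (G h) (G k) = rp (X h) (X k).
Proof.
have [saB _ _ _] := sqB; move=> Bz Bh Bw.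
have /= E := sa_rp saB Bh Bw; rewrite rpXX -E !rpE.
by rewrite subrK pG.1.1.
Qed.

(** By [sqB_form] the values z_n at G h_n are Cauchy as soon as the X h_n are, and [B] is closed. *)
Lemma sqB_value a : orthker G a -> exists2 w, B (X a, w) &
  exists h z, [/\ forall n, orthker G (h n), forall n : nat, B (G (h n), z n),
    forall n, B (z n, h n - G (h n)), cvs (fun n => X (h n)) a & cvs z w].
Proof.
have [saB _ _ _] := sqB; move=> /orthker_approx[h Kh ha].
have /choice[z zP] : forall n, exists z, B (G (h n), z) /\ B (z, h n - G (h n)).
  by move=> n; have [z] := sqB_image (Kh n); exists z.
have zh n m : nr (z n - z m) <= nr (X (h n) - a) + nr (X (h m) - a).
  apply: (@le_trans _ _ (nr (X (h n) - X (h m)))); last first.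
    by rewrite (nrB (X (h m))) nr_dist.
  apply: ler_of_sqr; rewrite ?nr_ge0 // !sqr_nr.
  have [zn1 zn2] := zP n; have [zm1 zm2] := zP m.
  rewrite !rpE (rpC (z m) (z n)) (rpC (X (h m)) (X (h n))).
  rewrite -(sqB_form zn1 zn2 zn1) -(sqB_form zn1 zn2 zm1) -(sqB_form zm1 zm2 zm1).
  have := rpxx_ge0 (G (h n) - G (h m)).
  by rewrite !rpE (rpC (G (h m)) (G (h n))); lra.
have [w zw] := complete_rate ha zh.
exists w; last by exists h, z; split=> // n; case: (zP n).
apply: (sa_closed saB (@subspace_orthker G) (@seq_closed_orthker G)
  (u := fun n => G (h n)) (v := z)) => //.
  by move=> n; case: (zP n).
under [X in cvs X]eq_fun do rewrite -XX.
exact: (cvs_bnd (fun k => pcop_nr k pX) ha).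
Qed.

(** With z the value of [B] at G h, symmetry gives (u, h) = (u, G h) + (w, z). Cauchy-Schwarz in the
    graph of [B] and [sqB_form] bound the square by (|u|^2 + |w|^2) (G h, h), that is,
    [oran G u]. *)
Lemma sqB_dom u w : B (u, w) -> exists2 a, orthker G a & u = X a.
Proof.
have [saB _ _ _] := sqB; move=> Buw.
have /= [Ku Kw] := sa_sub saB Buw.
have [P [PK Porth]] := projection (@subspace_orthker G) (@seq_closed_orthker G).
have bound h : orthker G h -> rp u h ^+ 2 <= (rp u u + rp w w) * rp (G h) h.
  move=> Kh; have [z Bz Bh] := sqB_image Kh.
  have /= E := sa_rp saB Buw Bh.
  have F := sqB_form Bz Bh Bz; rewrite rpXX in F.
  have -> : rp u h = rp u (G h) + rp w z by rewrite E -rpDr addrC subrK.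
  rewrite -F; have := rp_sqr_le u (G h); have := rp_sqr_le w z.
  have := rp_le u (G h); have := rp_le w z; rewrite -!sqr_nr.
  set a := nr u; set b := nr w; set c := nr z; set d := nr (G h).
  have [a0 b0 c0 d0] : [/\ 0 <= a, 0 <= b, 0 <= c & 0 <= d] by rewrite !nr_ge0.
  move=> wz ug _ _; apply: (@le_trans _ _ ((a * d + b * c) ^+ 2)); last first.
    by have := sqr_ge0 (a * c - b * d); lra.
  rewrite -real_normK ?num_real // ler_pXn2r ?nnegrE ?addr_ge0 ?mulr_ge0 //.
  by rewrite (le_trans (ler_normD _ _)) // lerD.
apply: sqrt_of_oran; exists (rp u u + rp w w); first by rewrite addr_ge0 ?rpxx_ge0.
move=> h; have [XP GP] := sqrt_orthker_projection h Porth.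
have -> : rp u h = rp u (P h).
  apply/eqP; rewrite -subr_eq0 -rpNr -rpDr Ku //.
  by rewrite linearB GP subrr.
by rewrite -rpXX -XP rpXX; exact: bound.
Qed.

Lemma sqB_rel_val u w : B (u, w) -> rel_val B u = w.
Proof.
move=> Buw; apply: (sqB_functional (x := u)) => //.
by apply: (@xgetPex _ 0 [set f | B (u, f)]); exists w.
Qed.

Lemma sqB_rp a b : orthker G a -> orthker G b ->
  rp (rel_val B (X a)) (rel_val B (X b)) = rp a b - rp (X a) (X b).
Proof.
move=> /sqB_value[w Bw [h [z [Kh Bz1 Bz2 ha zw]]]].
move=> /sqB_value[w' Bw' [h' [z' [Kh' Bz1' Bz2' ha' zw']]]].
rewrite (sqB_rel_val Bw) (sqB_rel_val Bw').
have C := cvs_bnd (fun k => pcop_nr k pX) ha.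
have C' := cvs_bnd (fun k => pcop_nr k pX) ha'.
have E n : rp (z n) (z' n) =
    rp (X (h n)) (X (h' n)) - rp (X (X (h n))) (X (X (h' n))).
  by rewrite -(sqB_form (Bz1 n) (Bz2 n) (Bz1' n)) !XX addrK.
have := cvs_rp zw zw'; under eq_fun do rewrite E.
move=> /cvg_lim <- //; apply: cvg_lim => //.
by apply: cvgB; exact: cvs_rp.
Qed.

End AnySquareRoot.
Local Notation t := (closed_form ip (rel G)).

Lemma sqrt_op_part_rel :
  is_sqrt_in ip (orthker G) (op_part ip (rel G)) (sqrt_op_part ip (rel G)).
Proof.
rewrite /sqrt_op_part closure_dom_rel; last exact: pG.1.1.
by apply: xgetPex; eexists; exact: sqrt_rel.
Qed.

Lemma closed_form_dom u : form_dom t u <-> exists2 a, orthker G a & u = X a.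
Proof.
split=> [[w Bw]|[a /(sqB_value sqrt_op_part_rel)[w Bw _] ->]]; last by exists w.
exact: (sqB_dom sqrt_op_part_rel Bw).
Qed.

Lemma closed_form_val a b : orthker G a -> orthker G b ->
  form_val t (X a) (X b) = ip a b - ip (X a) (X b).
Proof.
move=> Ka Kb; have sq := sqrt_op_part_rel; have [saB _ _ _] := sq.
have Kib : orthker G ('i *: b) by exact: (subspaceZ _ (@subspace_orthker G)).
rewrite /= !ip_rp; apply/eqP; rewrite eq_complex /= (sqB_rp sq) // eqxx /=.
have -> : 'i *: rel_val (sqrt_op_part ip (rel G)) (X b) =
    rel_val (sqrt_op_part ip (rel G)) (X ('i *: b)).
  apply/esym/(sqB_rel_val sq); have [w Bw _] := sqB_value sq Kb.
  rewrite (sqB_rel_val sq Bw) linZ -[(_, _)]/('i *: (X b, w)) -[_ *: _]addr0.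
  apply: (sa_linear saB) => //; first exact: subspace_orthker.
  apply: (sa_maximal saB) => //; try exact: subspace_orthker.
  - exact: (subspace_orthker G).1.
  - exact: (subspace_orthker G).1.
  by move=> p _; rewrite !rp0r.
by rewrite (sqB_rp sq) // linZ.
Qed.

End ClosedForm.

(** * A criterion for properties (1)-(3) *)

Section Criterion.
Variables G0 G1 E F : {linear H -> H}.
Hypotheses (pG0 : posop G0) (pE : posop E) (pF : posop F).
Hypothesis G1E : forall h, G1 h = G0 h + E h.
Hypothesis FE : forall h, F h = h - G1 h.
Hypothesis disj0 : forall u, oran E u -> oran G0 u -> u = 0.
Hypothesis disjF : forall u, oran E u -> oran F u -> u = 0.

Let sumE h k : rp (G0 h) k + rp (E h) k + rp (F h) k = rp h k.
Proof. by rewrite FE G1E !rpE; ring. Qed.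

Let pc0 : pcop G0.
Proof.
split=> // h; rewrite -[leRHS]sumE.
by have := pE.2 h; have := pF.2 h; lra.
Qed.

Let pcE : pcop E.
Proof.
split=> // h; rewrite -[leRHS]sumE.
by have := pG0.2 h; have := pF.2 h; lra.
Qed.

Let pc1 : pcop G1.
Proof.
split; first split.
- by move=> h k; rewrite !G1E !rpE pG0.1 pE.1.
- by move=> h; rewrite G1E rpDl addr_ge0 //; [exact: pG0.2|exact: pE.2].
- move=> h; rewrite -[leRHS]sumE G1E rpDl.
  by have := pF.2 h; lra.
Qed.

Section WithRoots.
Variables X0 Y0 X1 Y1 Q : {linear H -> H}.
Hypotheses (pX0 : pcop X0) (pX1 : pcop X1) (pY1 : pcop Y1) (pQ : pcop Q).
Hypotheses (pY0 : pcop Y0).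
Hypotheses (XX0 : forall h, X0 (X0 h) = G0 h) (YY0 : forall h, Y0 (Y0 h) = h - G0 h).
Hypothesis (XY0 : forall h, X0 (Y0 h) = Y0 (X0 h)).
Hypotheses (XX1 : forall h, X1 (X1 h) = G1 h) (YY1 : forall h, Y1 (Y1 h) = h - G1 h).
Hypothesis (XY1 : forall h, X1 (Y1 h) = Y1 (X1 h)).
Hypothesis (QQ : forall h, Q (Q h) = E h).

(* The closure of {(X1 h, (X0 h, Q h))}: an isometry from orthker G1 into
   orthker G0 (+) orthker E which intertwines X1 with (X0, Q). *)
Definition splits a a' e := exists h, [/\ cvs (fun n => X1 (h n)) a,
  cvs (fun n => X0 (h n)) a' & cvs (fun n => Q (h n)) e].

Lemma rpX1 h k : rp (X1 h) (X1 k) = rp (X0 h) (X0 k) + rp (Q h) (Q k).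
Proof.
by rewrite (rpXX pc1 pX1 XX1) (rpXX pc0 pX0 XX0) (rpXX pcE pQ QQ) G1E rpDl.
Qed.

Lemma splits_ex a : orthker G1 a -> exists a' e, splits a a' e.
Proof.
move=> /(orthker_approx pc1 pX1 XX1)[h Kh ha].
have le2 n m : nr (X1 (h n) - X1 (h m)) <= nr (X1 (h n) - a) + nr (X1 (h m) - a).
  by rewrite (nrB (X1 (h m))) nr_dist.
have sq k : nr (X0 k) <= nr (X1 k) /\ nr (Q k) <= nr (X1 k).
  split; apply: ler_of_sqr; rewrite ?nr_ge0 // !sqr_nr rpX1.
    by rewrite lerDl rpxx_ge0.
  by rewrite lerDr rpxx_ge0.
have [|a' ha'] := @complete_rate _ (fun n => X0 (h n)) ha.
  move=> n m; apply: le_trans (le2 _ _); rewrite -!linearB.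
  exact: (sq _).1.
have [|e he] := @complete_rate _ (fun n => Q (h n)) ha.
  move=> n m; apply: le_trans (le2 _ _); rewrite -!linearB.
  exact: (sq _).2.
by exists a', e, h.
Qed.

Lemma splits_rp a a' e b b' f : splits a a' e -> splits b b' f ->
  rp a b = rp a' b' + rp e f.
Proof.
move=> [h [ha ha' he]] [k [kb kb' kf]].
have := cvs_rp ha kb; under eq_fun do rewrite rpX1.
move=> /cvg_lim <- //; apply: cvg_lim => //.
by apply: cvgD; exact: cvs_rp.
Qed.

Lemma splits_val a a' e : splits a a' e -> X1 a = X0 a' + Q e.
Proof.
move=> [h [ha ha' he]].
have := cvs_bnd (fun k => pcop_nr k pX1) ha.
under [X in cvs X]eq_fun do rewrite XX1 G1E -XX0 -QQ.
move=> /cvs_unique; apply; apply: cvsD.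
  exact: (cvs_bnd (fun k => pcop_nr k pX0) ha').
exact: (cvs_bnd (fun k => pcop_nr k pQ) he).
Qed.

Lemma splits_orthker a a' e : splits a a' e -> orthker G0 a' /\ orthker E e.
Proof.
move=> [h [ha ha' he]]; split.
  by apply: (seq_closed_orthker _ ha') => n; exact: (orthkerX pX0 XX0).
by apply: (seq_closed_orthker _ he) => n; exact: (orthkerX pQ QQ).
Qed.

Lemma splitsZ (t : R[i]) a a' e : splits a a' e -> splits (t *: a) (t *: a') (t *: e).
Proof.
move=> [h [ha ha' he]]; exists (fun n => t *: h n).
by split; under [X in cvs X]eq_fun do rewrite linZ; exact: cvsZ.
Qed.

(** As G0 <= G1, X0 a = X1 b for some b. If b splits into (a', e), then Q e = X0 (a - a') lies in
    the ranges of both roots, so it is 0; hence e = 0 and a' = a. The isometry therefore preserves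
    inner products from a to b, which is the equality of the forms. *)
Lemma restrict_ex a : orthker G0 a ->
  exists b, [/\ orthker G1 b, X1 b = X0 a & splits b a 0].
Proof.
move=> Ka; have [c c0 uc] : oran G0 (X0 a) by exact: (oran_sqrt pc0 pX0 XX0).
have [|b Kb Xb] := sqrt_of_oran pc1 pX1 XX1 (u := X0 a).
  exists c => // h; apply: (le_trans (uc h)).
  by rewrite ler_wpM2l // G1E rpDl lerDl; exact: pE.2.
exists b; split=> //.
have [a' [e s]] := splits_ex Kb; have [Ka' Ke] := splits_orthker s.
have E0 : X0 (a - a') = Q e.
  by rewrite linearB Xb (splits_val s) addrC addKr.
have Q0 : Q e = 0.
  apply: disj0; first exact: (oran_sqrt pcE pQ QQ).
  by rewrite -E0; exact: (oran_sqrt pc0 pX0 XX0).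
have e0 : e = 0 by apply: (orthker_eq0 Ke); apply/(kerX pQ QQ).
suff /subr0_eq aa' : a - a' = 0 by move: s; rewrite -aa' e0.
apply: (@orthker_eq0 G0); first exact: (subspaceB (@subspace_orthker G0)).
by apply/(kerX pX0 XX0); rewrite E0.
Qed.

Local Notation t0 := (closed_form ip (rel G0)).
Local Notation t1 := (closed_form ip (rel G1)).

Let dom0 u : form_dom t0 u <-> exists2 a, orthker G0 a & u = X0 a.
Proof. exact: (closed_form_dom pc0 pX0 pY0 XX0 YY0 XY0). Qed.

Let dom1 u : form_dom t1 u <-> exists2 a, orthker G1 a & u = X1 a.
Proof. exact: (closed_form_dom pc1 pX1 pY1 XX1 YY1 XY1). Qed.

Lemma criterion_restriction : form_restriction t0 t1.
Proof.
split=> [u /dom0[a /restrict_ex[b [Kb Xb _]] ->]|u v].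
  by apply/dom1; exists b.
move=> /dom0[a Ka ->] /dom0[a' Ka' ->].
have [b [Kb Xb s]] := restrict_ex Ka; have [b' [Kb' Xb' s']] := restrict_ex Ka'.
rewrite (closed_form_val pc0 pX0 pY0 XX0 YY0 XY0) //.
rewrite -Xb -Xb' (closed_form_val pc1 pX1 pY1 XX1 YY1 XY1) //.
congr (_ - _); rewrite !ip_rp (splits_rp s s') (splits_rp s (splitsZ 'i s')).
by rewrite !rp0l !addr0.
Qed.

(** As t1[X1 h] = |Y1 h|^2, the infimum is |z|^2 for z the part of Y1 b orthogonal to Y1 D. Then Y1
    z is orthogonal to D, so its component in [orthker G0] vanishes and X1 Y1 z lies in ran E^{1/2}.
    It equals Y1 X1 z with Y1 = F^{1/2}, so it is 0; hence Y1 z = 0 and z = 0. *)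
Lemma criterion_inf u : form_dom t1 u ->
  ereal_inf [set (complex.Re (form_val t1 (u - phi) (u - phi)))%:E
            | phi in form_dom t0] = 0%E.
Proof.
move=> /dom1[b Kb ->].
pose D h := orthker G1 h /\ exists2 a, orthker G0 a & X1 h = X0 a.
have sD : subspace D.
  split.
    split; first exact: (subspace_orthker G1).1.
    by exists 0; rewrite ?linear0 //; exact: (subspace_orthker G0).1.
  move=> t x y [Kx [a Ka xa]] [Ky [c Kc yc]]; split.
    exact: (subspace_orthker G1).2.
  by exists (t *: a + c); [exact: (subspace_orthker G0).2|rewrite !linearP xa yc].
have val h : orthker G1 h ->
    complex.Re (form_val t1 (X1 h) (X1 h)) = rp (Y1 h) (Y1 h).
  move=> Kh; rewrite (closed_form_val pc1 pX1 pY1 XX1 YY1 XY1) // raddfB /=.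
  by rewrite -!/(rp _ _) pX1.1.1 XX1 pY1.1.1 YY1 !rpE.
have [||||g [m [Dg gm lm]]] := @riesz Y1 D (fun h => rp (Y1 h) (Y1 b)) (rp (Y1 b) (Y1 b)).
- exact: sD.
- by move=> t x y _ _; rewrite linearP !rpE.
- exact: rpxx_ge0.
- by move=> h _; rewrite mulrC rp_sqr_le.
set z := Y1 b - m.
have bz : cvs (fun n => Y1 (b - g n)) z.
  under [X in cvs X]eq_fun do rewrite linearB.
  by apply: cvsB => //; exact: cvs_cst.
have Kbg n : orthker G1 (b - g n).
  by apply: (subspaceB (@subspace_orthker G1)) => //; exact: (Dg n).1.
have Kz : orthker G1 z.
  apply: (seq_closed_orthker _ bz) => n; exact: (orthkerY pY1 XX1 XY1).
have Kw : orthker G1 (Y1 z) by exact: (orthkerY pY1 XX1 XY1).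
have [a' [e s]] := splits_ex Kw; have [Ka' Ke] := splits_orthker s.
have [d [Kd Xd sd]] := restrict_ex Ka'.
have a0 : a' = 0.
  apply: rp_eq0; have := splits_rp s sd; rewrite rp0r addr0 => <-.
  rewrite pY1.1.1 /z rpC rpDr rpNr lm ?subrr //.
  by split=> //; exists a'.
have X1w : X1 (Y1 z) = 0.
  apply: disjF.
    rewrite (splits_val s) a0 linear0 add0r; exact: (oran_sqrt pcE pQ QQ).
  rewrite XY1; exists (rp (X1 z) (X1 z)) => [|h]; first exact: rpxx_ge0.
  by rewrite pY1.1.1 FE -YY1 (pY1.1.1 (Y1 h)) rp_sqr_le.
have Y1z : Y1 z = 0.
  by apply: (orthker_eq0 Kw); apply/(kerX pX1 XX1).
have z0 : z = 0.
  apply: rp_eq0; have := cvs_rp (cvs_cst z) bz.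
  under eq_fun do rewrite -pY1.1.1 Y1z rp0l.
  by move=> /cvg_lim <- //; rewrite lim_cst.
apply/eqP; rewrite eq_le; apply/andP; split; last first.
  apply: le_ereal_inf_tmp => _ [phi /dom0[a Ka ->] <-].
  have [c [Kc <- _]] := restrict_ex Ka.
  rewrite -linearB lee_fin val ?rpxx_ge0 //.
  exact: (subspaceB (@subspace_orthker G1)).
apply/lee_addgt0Pr => eps e0; rewrite add0e.
have := cvs_rp bz bz; rewrite z0 rp0l => /cvgrPdist_lt/(_ _ e0)[n _ /(_ n (leqnn n))].
rewrite /= sub0r normrN ger0_norm ?rpxx_ge0 // => small.
have [Kg [a Ka ga]] := Dg n.
apply: (@le_trans _ _ (rp (Y1 (b - g n)) (Y1 (b - g n)))%:E); last first.
  by rewrite lee_fin ltW.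
apply: ereal_inf_lbound; exists (X1 (g n)).
  by apply/dom0; exists a.
by rewrite -linearB val.
Qed.

End WithRoots.

Lemma disjoint_restriction_pair_criterion (S : set (H * H)) :
    S `<=` rel G0 -> S `<=` rel G1 ->
    (forall p, rel G0 p -> E (p.1 + p.2) = 0 -> S p) ->
  disjoint_restriction_pair ip S (rel G0) (rel G1).
Proof.
move=> S0 S1 SE.
have [X0 [Y0 [pX0 pY0 XX0 YY0 XY0]]] := sqrtop_pair pc0.
have [X1 [Y1 [pX1 pY1 XX1 YY1 XY1]]] := sqrtop_pair pc1.
have [Q [pQ QQ _]] := sqrtop pcE.
have ext G : pcop G -> S `<=` rel G -> nonneg_sa_extension ip S (rel G).
  by move=> pG SG; split=> //; [exact: rel_selfadjoint|exact: rel_nonnegative].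
split.
- exact: ext.
- exact: ext.
- apply/seteqP; split=> [p [p0 p1]|p Sp]; last by split; [exact: S0|exact: S1].
  apply: SE => //; move: p0 p1; rewrite /rel /= G1E => {1}-> /eqP.
  by rewrite -subr_eq0 opprD addrA subrr sub0r oppr_eq0 => /eqP.
- exact: (criterion_restriction pX0 pX1 pY1 pQ pY0 XX0 YY0 XY0 XX1 YY1 XY1 QQ).
- move=> u; exact: (criterion_inf pX0 pX1 pY1 pQ pY0 XX0 YY0 XY0 XX1 YY1 XY1 QQ).
Qed.

End Criterion.

(** * Shorted operators *)

Lemma projection_pcop (D : set H) (P : {linear H -> H}) :
    (forall x, D (P x)) -> (forall x d, D d -> rp (x - P x) d = 0) ->
  pcop P /\ forall x, P (P x) = P x.
Proof.
move=> DP orth.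
have E x y : rp (P x) y = rp (P x) (P y).
  apply/eqP; rewrite -subr_eq0 -rpNr -rpDr rpC orth //.
have sP : symop P by move=> x y; rewrite E rpC -E rpC.
split; first split; first split=> //.
- by move=> h; rewrite E rpxx_ge0.
- move=> h; have := rpxx_ge0 (h - P h).
  by rewrite rpDr rpNr (orth h (P h)) // subr0 rpDl rpNl subr_ge0.
by move=> x; apply: rp_inj => h; rewrite sP -E.
Qed.

Section Shorted.
Variable D : set H.
Hypotheses (sD : subspace D).

(* The largest positive operator below A which vanishes on D, characterised by
   <B h, h> = inf {<A (h - g), h - g> : g in D}. *)
Definition shorted (A B : {linear H -> H}) :=
  [/\ posop B, forall h, rp (B h) h <= rp (A h) h, forall g, D g -> B g = 0
    & forall h eps, 0 < eps ->
        exists2 g, D g & rp (A (h - g)) (h - g) <= rp (B h) h + eps].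

(** B = X P X with X = A^{1/2} and P the projection onto the orthogonal complement of X D: |P X h|
    is the distance from X h to X D. *)
Lemma shorted_ex (A : {linear H -> H}) : pcop A ->
  exists B : {linear H -> H}, shorted A B.
Proof.
move=> pA; have [X [pX XX _]] := sqrtop pA.
pose XD : set H := [set X g | g in D].
have sXD : subspace XD.
  split; first by exists 0; [exact: sD.1|exact: linear0].
  move=> a _ _ [x Dx <-] [y Dy <-]; exists (a *: x + y); first exact: sD.2.
  by rewrite linearP.
have [P [MP orth]] := projection (subspace_orth sXD) (@seq_closed_orth XD).
have [pP PP] := projection_pcop MP orth.
pose B := (X \o P \o X : {linear H -> H}).
have BE h : rp (B h) h = rp (P (X h)) (P (X h)).
  by rewrite /B /= pX.1.1 -pP.1.1 PP.
have pB : posop B.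
  split=> [x y|h]; last by rewrite BE rpxx_ge0.
  by rewrite /B /= pX.1.1 pP.1.1 pX.1.1.
exists B; split=> //.
- by move=> h; rewrite BE -XX pX.1.1 -pP.1.1 PP; exact: (pP.2 (X h)).
- move=> g Dg; apply: posop_eq0 => //; rewrite BE.
  by rewrite pP.1.1 PP rpC MP //; exists g.
move=> h eps e0.
have [||||g [m [Dg gm lm]]] := @riesz X D (fun g => rp (X g) (X h)) (rp (X h) (X h)).
- exact: sD.
- by move=> t x y _ _; rewrite linearP !rpE.
- exact: rpxx_ge0.
- by move=> k _; rewrite mulrC rp_sqr_le.
have PXh : P (X h) = X h - m.
  apply/esym/subr0_eq; set w := _ - P _.
  have Mw d : XD d -> rp w d = 0.
    move=> XDd; rewrite rpDl rpNl (MP _ _ XDd) subr0.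
    by case: XDd => k Dk <-; rewrite rpDl rpNl (rpC m) -lm // rpC subrr.
  have mM v : (forall d, XD d -> rp v d = 0) -> rp m v = 0.
    move=> Mv; have := cvs_rp gm (cvs_cst v).
    have Z n : rp (X (g n)) v = 0 by rewrite rpC Mv //; exists (g n).
    under eq_fun do rewrite Z.
    by move=> /cvg_lim <- //; rewrite lim_cst.
  apply: rp_eq0; rewrite {1}/w addrAC rpDl rpNl mM // subr0; exact: orth.
have hg : cvs (fun n => X (h - g n)) (P (X h)).
  under [X in cvs X]eq_fun do rewrite linearB.
  by rewrite PXh; apply: cvsB => //; exact: cvs_cst.
have /cvgrPdist_le/(_ _ e0)[n _ /(_ n (leqnn n))/=] := cvs_rp hg hg.
rewrite distrC => /(le_trans (ler_norm _)); rewrite lerBlDl => le_eps.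
exists (g n) => //; rewrite BE -XX pX.1.1 //.
Qed.

Variables A B : {linear H -> H}.
Hypothesis AB : shorted A B.

Lemma vanish_orth (C : {linear H -> H}) h g : symop C -> (forall g, D g -> C g = 0) ->
  D g -> rp (C (h - g)) (h - g) = rp (C h) h.
Proof.
move=> sC C0 Dg; have -> : C (h - g) = C h by rewrite linearB (C0 _ Dg) subr0.
by rewrite rpDr rpNr (sC h g) (C0 _ Dg) rp0r subr0.
Qed.

(** The form of C is unchanged by a shift along D, so A + C >= 0 at h - g, with g nearly optimal,
    gives B + C >= 0 at h. C may have any sign; [shorted_ker] takes both signs of a difference. *)
Lemma shorted_max (C : {linear H -> H}) : symop C -> (forall g, D g -> C g = 0) ->
  (forall h, 0 <= rp (A h) h + rp (C h) h) ->
  forall h, 0 <= rp (B h) h + rp (C h) h.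
Proof.
move=> sC C0 AC h; apply/ler_addgt0Pr => eps e0; have [_ _ _ inf] := AB.
have [g Dg Ag] := inf h eps e0; have := AC (h - g).
by rewrite (vanish_orth h sC C0 Dg); lra.
Qed.

(** Replacing h by h - g with g in D changes neither (u, h) nor (C h, h), and makes the contribution
    of A - B as small as desired. *)
Lemma shorted_oran (G C : {linear H -> H}) u : posop C ->
  (forall g, D g -> C g = 0) -> (forall g, D g -> rp u g = 0) ->
  (forall h, G h = A h - B h + C h) -> oran G u -> oran C u.
Proof.
have [pB _ B0 inf] := AB; move=> pC C0 u0 GE [c c0 uc]; exists c => // h.
apply/ler_addgt0Pr => eps e0.
(* The error gets multiplied by c; c + 1 also covers c = 0. *)
have e1 : 0 < eps / (c + 1) by rewrite divr_gt0 // ltr_wpDl.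
have [g Dg Ag] := inf h _ e1.
have := uc (h - g); rewrite GE 2!rpDl rpNl.
rewrite (vanish_orth h pC.1 C0 Dg) (vanish_orth h pB.1 B0 Dg).
rewrite rpDr rpNr (u0 _ Dg) subr0 => /le_trans; apply.
apply: (@le_trans _ _ (c * (rp (C h) h + eps / (c + 1)))).
  by rewrite ler_wpM2l //; lra.
rewrite mulrDr lerD2l mulrCA; apply: ler_piMr; first exact: ltW.
by rewrite ler_pdivrMr ?mul1r ?lerDl ?ltr_wpDl.
Qed.

End Shorted.

(** * The mean of two resolvents, shorted to the defect space *)

Section DisjointExtensions.
Variables Ga Gb : {linear H -> H}.
Hypotheses (pa : pcop Ga) (pb : pcop Gb).

(** This is ran (S + 1) for S the intersection of [rel Ga] and [rel Gb]. *)
Definition coincidence : set H := [set h | Ga h = Gb h].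

Lemma subspace_coincidence : subspace coincidence.
Proof.
split=> [|a x y]; first by rewrite /coincidence /= !linear0.
by rewrite /coincidence /= => Cx Cy; rewrite !linearP Cx Cy.
Qed.

Variables meanop comean : {linear H -> H}.
Hypothesis meanopE : forall h, meanop h = (2^-1)%:C *: (Ga h + Gb h).
Hypothesis comeanE : forall h, comean h = h - meanop h.

Lemma pcop_mean : pcop meanop.
Proof.
split; first split => [x y|h].
- by rewrite !meanopE !rpE pa.1.1 pb.1.1.
- by rewrite meanopE !rpE; have := pa.1.2 h; have := pb.1.2 h; lra.
by move=> h; rewrite meanopE !rpE; have := pa.2 h; have := pb.2 h; lra.
Qed.

Lemma pcop_comean : pcop comean.
Proof.
have [[sm pm] m1] := pcop_mean.
split; first split => [x y|h].
- by rewrite !comeanE !rpE sm.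
- by rewrite !comeanE !rpE subr_ge0.
by move=> h; rewrite !comeanE !rpE lerBlDr lerDl.
Qed.

Variables B B' : {linear H -> H}.
Hypotheses (shB : shorted coincidence meanop B).
Hypotheses (shB' : shorted coincidence comean B').

(** C = (Gb - Ga) / 2 vanishes on [coincidence], and the mean plus or minus C is Gb or Ga, so B + C
    and B - C are nonnegative by [shorted_max]. At a vector h with B h = 0 this forces (C h, h) = 0,
    then (B + C) h = 0 and C h = 0. *)
Lemma shorted_ker h : rp (B h) h + rp (B' h) h = 0 -> coincidence h.
Proof.
have [pB _ B0 _] := shB; have [pB' _ _ _] := shB'.
move=> sum0; have Bh0 : rp (B h) h = 0.
  by have := pB.2 h; have := pB'.2 h; lra.
have Bh := posop_eq0 pB Bh0.
pose C : {linear H -> H} := (2^-1)%:C \*: (Gb \- Ga).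
pose C' : {linear H -> H} := (2^-1)%:C \*: (Ga \- Gb).
have sC : symop C by move=> x y; rewrite /C /= !rpE pa.1.1 pb.1.1.
have sC' : symop C' by move=> x y; rewrite /C' /= !rpE pa.1.1 pb.1.1.
have C0 g : coincidence g -> C g = 0.
  by rewrite /coincidence /C /= => ->; rewrite subrr scaler0.
have C0' g : coincidence g -> C' g = 0.
  by rewrite /coincidence /C' /= => ->; rewrite subrr scaler0.
have BC : posop (B \+ C : {linear H -> H}).
  split=> [x y|k]; first by rewrite /= rpDl rpDr pB.1 sC.
  rewrite -[X in rp X _]/(B k + C k) rpDl; apply: (shorted_max shB sC C0) => {}k.
  by rewrite meanopE /C /= !rpE; have := pb.1.2 k; lra.
have BC' k : 0 <= rp (B k) k + rp (C' k) k.
  apply: (shorted_max shB sC' C0') => {}k.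
  by rewrite meanopE /C' /= !rpE; have := pa.1.2 k; lra.
have Ch0 : rp (C h) h = 0.
  have := BC.2 h; have := BC' h; rewrite /= !rpDl Bh0 /C /C' /= !rpE.
  by lra.
have := @posop_eq0 _ h BC; rewrite /= rpDl Bh0 Ch0 Bh !add0r => /(_ erefl) Ch.
apply: rp_inj => k; have := congr1 (rp^~ k) Ch; rewrite /= !rpE.
by lra.
Qed.

(** With F = comean - B' + D1, the hypothesis on the sum reads G0 + E + F = 1. Each of D0, E, D1
    lies between 0 and B + B', so it vanishes on [coincidence], where G0 and G1 thus agree with Ga.
    Vectors of ran E^{1/2} are orthogonal to [coincidence], so [shorted_oran] reduces the two range
    conditions of the criterion to those on D0 and D1. *)
Lemma pair_of_decomposition (D0 E D1 : {linear H -> H}) :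
    posop D0 -> posop E -> posop D1 ->
    (forall h, D0 h + E h + D1 h = B h + B' h) ->
    (forall h, E h = 0 -> coincidence h) ->
    (forall u, oran E u -> oran D0 u -> u = 0) ->
    (forall u, oran E u -> oran D1 u -> u = 0) ->
  let G0 : {linear H -> H} := (meanop \- B) \+ D0 in
  let G1 : {linear H -> H} := G0 \+ E in
  disjoint_restriction_pair ip (rel Ga `&` rel Gb) (rel G0) (rel G1).
Proof.
move=> p0 pE p1 sumD kerE dis0 dis1 G0 G1.
have [pB BA B0 _] := shB; have [pB' BA' B0' _] := shB'.
have van (C : {linear H -> H}) : posop C ->
    (forall h, rp (C h) h <= rp (B h + B' h) h) ->
    forall g, coincidence g -> C g = 0.
  move=> pC CB g Cg; apply: posop_eq0 => //; apply/eqP.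
  by rewrite eq_le pC.2 andbT; have := CB g; rewrite B0 // B0' // addr0 rp0l.
have D00 : forall g, coincidence g -> D0 g = 0.
  apply: van => // h; rewrite -sumD !rpDl.
  by have := pE.2 h; have := p1.2 h; lra.
have E0 : forall g, coincidence g -> E g = 0.
  apply: van => // h; rewrite -sumD !rpDl.
  by have := p0.2 h; have := p1.2 h; lra.
have D10 : forall g, coincidence g -> D1 g = 0.
  apply: van => // h; rewrite -sumD !rpDl.
  by have := p0.2 h; have := pE.2 h; lra.
have orth u g : oran E u -> coincidence g -> rp u g = 0.
  move=> [c c0 uc] Cg; apply/eqP; rewrite -sqrf_eq0 eq_le sqr_ge0 andbT.
  by have := uc g; rewrite E0 // rp0l mulr0.
pose F : {linear H -> H} := (comean \- B') \+ D1.
have pos (A C C' : {linear H -> H}) : posop A -> posop C -> posop C' ->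
    (forall h, rp (C h) h <= rp (A h) h) -> posop ((A \- C) \+ C' : {linear H -> H}).
  move=> pA pC pC' CA; split=> [x y|h]; first by rewrite /= !rpE pA.1 pC.1 pC'.1.
  by rewrite /= !rpE; have := pC'.2 h; have := CA h; lra.
have G0C h : coincidence h -> G0 h = Ga h.
  move=> C; rewrite -[LHS]/(meanop h - B h + D0 h) B0 // D00 // subr0 addr0 meanopE.
  by rewrite -(C : Ga h = Gb h); apply: rp_inj => k; rewrite !rpE; lra.
apply: (@disjoint_restriction_pair_criterion G0 G1 E F) => //.
- by apply: pos => //; exact: pcop_mean.1.
- by apply: pos => //; exact: pcop_comean.1.
- move=> h; apply: rp_inj => k; have := congr1 (rp^~ k) (sumD h).
  by rewrite /F /G1 /G0 /= comeanE !rpE; lra.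
- move=> u Eu G0u; apply: dis0 => //.
  by apply: (shorted_oran shB p0 D00 _ _ G0u) => // g; exact: orth.
- move=> u Eu Fu; apply: dis1 => //.
  by apply: (shorted_oran shB' p1 D10 _ _ Fu) => // g; exact: orth.
- move=> p [pa' pb']; have C : coincidence (p.1 + p.2).
    by rewrite /coincidence /= -pa' -pb'.
  by rewrite -[rel G0 p]/(p.1 = G0 (p.1 + p.2)) G0C.
- move=> p [pa' pb']; have C : coincidence (p.1 + p.2).
    by rewrite /coincidence /= -pa' -pb'.
  rewrite -[rel G1 p]/(p.1 = G0 (p.1 + p.2) + E (p.1 + p.2)) G0C //.
  by rewrite E0 // addr0.
- move=> p p0' /kerE C; have : p.1 = G0 (p.1 + p.2) by [].
  by rewrite G0C // => pa'; split => //; rewrite /rel /= -(C : Ga _ = Gb _).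
Qed.

End DisjointExtensions.

(** * Disjoint operator ranges *)

(** Complex Cauchy-Schwarz, obtained from the real one at x and (x, y) y. *)
Lemma ip_le x y : nr (ip x y *: y) <= nr x * nr y ^+ 2.
Proof.
set z := ip x y.
have E : rp x (z *: y) = complex.Re `|z| ^+ 2.
  rewrite /rp ipZr -/z mulrC -sqr_normc expr2 ReM.
  by rewrite mulr0 subr0.
have := le_trans (ler_norm _) (rp_le x (z *: y)); rewrite E nrZ.
set a := complex.Re _; have a0 : 0 <= a.
  by rewrite /a; have := normr_ge0 z; rewrite lecE => /andP[].
move=> aa; rewrite expr2 mulrA; apply: ler_wpM2r; first exact: nr_ge0.
have [->|an0] := eqVneq a 0; first by rewrite mulr_ge0 ?nr_ge0.
have a_gt0 : 0 < a by rewrite lt0r an0.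
by rewrite -(ler_pM2l a_gt0) -expr2 (le_trans aa) // mulrCA.
Qed.

Section DiagonalSeries.
Variables (c : nat -> R) (b : R) (p q : nat -> H).
Hypothesis c_bound : forall j, 0 <= c j <= b * 2^-1 ^+ j.+1.
Hypotheses (p1 : forall j, ip (p j) (p j) = 1) (q1 : forall j, ip (q j) (q j) = 1).

Definition psum n h := \sum_(j < n) ((c j)%:C * ip h (p j)) *: q j.

Lemma psumS n h : psum n.+1 h = psum n h + ((c n)%:C * ip h (p n)) *: q n.
Proof. by rewrite /psum big_ord_recr. Qed.

Lemma unit_nr v : ip v v = 1 -> nr v = 1.
Proof. by rewrite /nr /rp => -> /=; rewrite sqrtr1. Qed.

Lemma psum_linear n a u v : psum n (a *: u + v) = a *: psum n u + psum n v.
Proof.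
rewrite /psum scaler_sumr -big_split /=; apply: eq_bigr => j _.
by rewrite ipDl ipZl mulrDr scalerDl scalerA mulrCA.
Qed.

Lemma b_ge0 : 0 <= b.
Proof.
have /andP[c0 /(le_trans c0)] := c_bound 0.
by rewrite pmulr_lge0 // exprn_gt0 // invr_gt0.
Qed.

Lemma psum_dist n m h : (n <= m)%N ->
  nr (psum m h - psum n h) <= b * (2^-1 ^+ n - 2^-1 ^+ m) * nr h.
Proof.
move=> /subnK <-; elim: (m - n)%N => [|k IH].
  by rewrite add0n !subrr nr0 mulr0 mul0r.
rewrite addSn psumS addrAC (le_trans (nrD _ _)) //.
set N := (k + n)%N in IH *.
have -> : b * (2^-1 ^+ n - 2^-1 ^+ N.+1) * nr h =
    b * (2^-1 ^+ n - 2^-1 ^+ N) * nr h + b * 2^-1 ^+ N.+1 * nr h.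
  by rewrite exprS; field.
rewrite lerD // -scalerA nrZr.
have /andP[c0 cb] := c_bound N.
rewrite ger0_norm // nrZ unit_nr // mulr1.
have := ip_le h (p N); rewrite nrZ unit_nr // mulr1 expr1n mulr1 => le_h.
have z0 : 0 <= complex.Re `|ip h (p N)|.
  by have := normr_ge0 (ip h (p N)); rewrite lecE => /andP[].
by apply: ler_pM.
Qed.

Lemma half_to0 : (fun n => 2^-1 ^+ n : R) @ \oo --> 0.
Proof. by apply: cvg_expr; rewrite ger0_norm ?invr_ge0 // invf_lt1 ?ltr1n. Qed.

(** Convergence rests on summable coefficients and unit vectors alone, because [twisted_contraction]
    uses a sequence [p] that takes each of its values infinitely often. *)
Lemma series_ex : exists L : {linear H -> H},
  (forall h, cvs (fun n => psum n h) (L h)) /\ forall h, nr (L h) <= b * nr h.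
Proof.
have /choice[l lP] : forall h, exists x, cvs (fun n => psum n h) x.
  move=> h; apply: (@complete_rate (fun n => b * 2^-1 ^+ n * nr h)).
    rewrite -[X in _ --> X](_ : b * 0 * nr h = 0); last by rewrite mulr0 mul0r.
    apply: cvgM; last exact: cvg_cst.
    by apply: cvgM; [exact: cvg_cst|exact: half_to0].
  have half0 n : 0 <= 2^-1 ^+ n :> R by rewrite exprn_ge0 ?invr_ge0.
  have key n m : (n <= m)%N ->
      nr (psum m h - psum n h) <= b * 2^-1 ^+ n * nr h + b * 2^-1 ^+ m * nr h.
    move=> /(psum_dist h)/le_trans; apply; rewrite -mulrDl -mulrDr.
    apply: ler_wpM2r; first exact: nr_ge0.
    apply: ler_wpM2l; first exact: b_ge0.
    by rewrite lerD2l; have := half0 m; lra.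
  move=> n m; have [/key|/ltnW/key] := leqP n m; first by rewrite nrB.
  by rewrite [leRHS]addrC.
have [|L LE] := @linear_ex l.
  move=> a u v; apply: (cvs_unique (lP _)).
  under [X in cvs X]eq_fun do rewrite psum_linear.
  by apply: cvsD => //; exact: cvsZ.
exists L; split=> [h|h]; rewrite LE //.
apply: ler_of_sqr; first by rewrite mulr_ge0 ?b_ge0 ?nr_ge0.
rewrite sqr_nr; apply: (cvgr_to_le (cvs_rp (lP h) (lP h))); apply: nearW => n.
rewrite -sqr_nr ler_pXn2r ?nnegrE ?mulr_ge0 ?b_ge0 ?nr_ge0 //.
have := psum_dist h (leq0n n); rewrite {2}/psum big_ord0 subr0 => /le_trans; apply.
apply: ler_wpM2r; first exact: nr_ge0.
by rewrite expr0 ler_piMr ?b_ge0 // gerBl exprn_ge0 ?invr_ge0.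
Qed.

End DiagonalSeries.

Lemma cvs_ip_const u x m z N : cvs u x -> (forall n, (N <= n)%N -> ip (u n) m = z) ->
  ip x m = z.
Proof.
move=> ux uz; have L k w : (forall n, (N <= n)%N -> rp (u n) k = w) -> rp x k = w.
  move=> uw; have := cvs_rp ux (cvs_cst k).
  have : (fun n => rp (u n) k) @ \oo --> w.
    apply/cvgrPdist_le => eps e0; exists N => // n /= /uw ->.
    by rewrite subrr normr0 ltW.
  by move=> /cvg_lim <- // /cvg_lim <-.
rewrite ip_rp (L m (complex.Re z)) => [|n /uz]; last by rewrite /rp => ->.
rewrite (L ('i *: m) (complex.Im z)) => [|n /uz]; first by case: (z).
by rewrite ip_rp => <-.
Qed.

Lemma ip_inj x y : (forall h, ip x h = ip y h) -> x = y.
Proof. by move=> xy; apply: rp_inj => h; rewrite /rp xy. Qed.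

Section SeriesLimit.
Variables (c : nat -> R) (p q : nat -> H) (L : {linear H -> H}).
Hypothesis Lp : forall h, cvs (fun n => psum c p q n h) (L h).

Lemma ip_psum n h m :
  ip (psum c p q n h) m = \sum_(j < n) (c j)%:C * ip h (p j) * ip (q j) m.
Proof.
elim: n => [|n IH]; first by rewrite /psum !big_ord0 linear0l.
by rewrite psumS ipDl IH ipZl big_ord_recr.
Qed.

Lemma series_orth h m : (forall j, ip (q j) m = 0) -> ip (L h) m = 0.
Proof.
move=> q0; apply: (cvs_ip_const (N := 0) (Lp h)) => n _.
by rewrite ip_psum big1 // => j _; rewrite q0 mulr0.
Qed.

Lemma series_single h n : (forall j, j != n -> ip h (p j) = 0) ->
  L h = ((c n)%:C * ip h (p n)) *: q n.
Proof.
move=> p0; apply: ip_inj => m.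
apply: (cvs_ip_const (N := n.+1) (Lp h)) => k nk; rewrite ip_psum.
rewrite (bigD1 (Ordinal nk)) //= big1 ?addr0 ?ipZl // => j jn.
by rewrite p0 ?mulr0 ?mul0r.
Qed.

Lemma series_coord h j : (forall i k, ip (q i) (q k) = (i == k)%:R) ->
  ip (L h) (q j) = (c j)%:C * ip h (p j).
Proof.
move=> oq; apply: (cvs_ip_const (N := j.+1) (Lp h)) => n jn; rewrite ip_psum.
rewrite (bigD1 (Ordinal jn)) //= oq eqxx mulr1 big1 ?addr0 // => i ij.
by rewrite oq (negbTE (ij : (i : nat) != j)) mulr0.
Qed.

End SeriesLimit.

Lemma subspace_annihilator (x : nat -> H) : subspace [set w | forall n, ip (x n) w = 0].
Proof.
split=> [n|a u v xu xv n] /=; first by rewrite linear0r.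
by rewrite ipDr ipZr xu xv mulr0 addr0.
Qed.

Lemma ip_comm0 u v : ip u v = 0 -> ip v u = 0.
Proof. by move=> uv; rewrite hermC /= expr0 mul1r uv rmorph0. Qed.

(** The closed span of the x_n is taken as a double annihilator. *)
Lemma span_closure_projection (x : nat -> H) :
  exists P : {linear H -> H}, [/\ pcop P, forall v, P (P v) = P v,
    forall v w, (forall n, ip (x n) w = 0) -> rp (P v) w = 0,
    forall n, P (x n) = x n & forall v, (forall n, ip (x n) v = 0) -> P v = 0].
Proof.
have [P [MP orth]] := projection (subspace_orth (subspace_annihilator x))
  (@seq_closed_orth [set w | forall n, ip (x n) w = 0]).
have [pP PP] := projection_pcop MP orth.
exists P; split=> // [n|v xv].
  apply/esym/subr0_eq/rp_eq0.
  rewrite rpDr rpNr (orth _ (P (x n))) // subr0 orth //.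
  by move=> w xw /=; rewrite /rp xw.
by apply: rp_eq0; rewrite pP.1.1 PP rpC MP.
Qed.

(** The 2-adic valuation of j + 1 takes every value infinitely often. *)
Definition dyadic (j : nat) := logn 2 j.+1.

Lemma dyadic_large n i : exists2 j, (i <= j)%N & dyadic j = n.
Proof.
have i2 : (i < 2 ^ n * i.*2.+1)%N.
  apply: (leq_trans _ (leq_pmull _ _)); last by rewrite expn_gt0.
  by rewrite ltnS -addnn leq_addr.
have gt0 := leq_ltn_trans (leq0n i) i2.
exists (2 ^ n * i.*2.+1).-1; first by rewrite -ltnS prednK.
rewrite /dyadic prednK //.
rewrite lognM ?expn_gt0 // pfactorK // logn_coprime ?addn0 //.
by rewrite coprime2n /= odd_double.
Qed.

(** * An operator range avoiding two orthogonal subspaces *)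

Section Twisted.
Variable z : nat -> H.
Hypothesis oz : forall i j, ip (z i) (z j) = (i == j)%:R.

Let x n := z n.*2.
Let y n := z n.*2.+1.

Let ox i j : ip (x i) (x j) = (i == j)%:R.
Proof. by rewrite oz -!muln2 eqn_mul2r. Qed.

Let oy i j : ip (y i) (y j) = (i == j)%:R.
Proof. by rewrite oz eqSS -!muln2 eqn_mul2r. Qed.

Let oxy i j : ip (x i) (y j) = 0.
Proof.
rewrite oz; case: eqP => // /(congr1 odd).
by rewrite /= !odd_double.
Qed.

Let oyx i j : ip (y i) (x j) = 0.
Proof. exact: ip_comm0 (oxy j i). Qed.

Let x1 j : ip (x j) (x j) = 1.
Proof. by rewrite ox eqxx. Qed.

Let y1 j : ip (y j) (y j) = 1.
Proof. by rewrite oy eqxx. Qed.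

(** The extra factor 2^-j makes a_j / c_j = 2^-j / 4 tend to 0, on which the injectivity of O rests.
    The constants keep the norms of O and C at most 1/2. *)
Let a j : R := 8^-1 * 2^-1 ^+ j.+1 * 2^-1 ^+ j.
Let c j : R := 2^-1 * 2^-1 ^+ j.+1.

Let half_ge0 j : 0 <= 2^-1 ^+ j :> R.
Proof. by rewrite exprn_ge0 // invr_ge0. Qed.

Let half_gt0 j : 0 < 2^-1 ^+ j :> R.
Proof. by rewrite exprn_gt0 // invr_gt0. Qed.

Let half_le1 j : 2^-1 ^+ j <= 1 :> R.
Proof. by rewrite exprn_ile1 ?invr_ge0 // invf_le1 ?ler1n. Qed.

Let a_bound j : 0 <= a j <= 8^-1 * 2^-1 ^+ j.+1.
Proof.
have e0 : 0 <= 8^-1 * 2^-1 ^+ j.+1 :> R by rewrite mulr_ge0 ?invr_ge0.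
by rewrite /a mulr_ge0 //= ler_piMr.
Qed.

Let a_gt0 j : 0 < a j.
Proof. by rewrite /a !mulr_gt0 // invr_gt0. Qed.

Let c_bound j : 0 <= c j <= 2^-1 * 2^-1 ^+ j.+1.
Proof. by rewrite lexx andbT /c mulr_ge0 ?invr_ge0. Qed.

Let c_gt0 j : 0 < c j.
Proof. by rewrite /c !mulr_gt0 // invr_gt0. Qed.

(* O = D1 + (1 - C) D2 maps the closed spans N1 of x and N2 of y onto dense
   subspaces of N1, and is nevertheless injective on N1 (+) N2. *)
Lemma twisted_contraction : exists O p1 p2 : {linear H -> H},
  [/\ [/\ pcop p1, pcop p2, forall v, p1 (p1 v) = p1 v, forall v, p2 (p2 v) = p2 v
        & forall v, p1 (p2 v) = 0],
      forall v w, (forall n, ip (z n) w = 0) -> rp (p1 v) w = 0 /\ rp (p2 v) w = 0,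
      p1 (x 0) = x 0 /\ forall v, nr (O v) <= 2^-1 * nr (p1 v + p2 v),
      forall v, O v = 0 -> p1 v + p2 v = 0
    & forall u (b : R), 0 <= b -> (forall h, rp u h ^+ 2 <= b * rp (O h) (O h)) ->
        p1 u = u \/ p2 u = u -> u = 0].
Proof.
have [D1 [L1 b1]] := series_ex a_bound x1 x1.
have [D2 [L2 b2]] := series_ex a_bound y1 x1.
have [C [LC bC]] := series_ex c_bound (p := x \o dyadic) (fun j => x1 (dyadic j)) x1.
have [p1 [pp1 p1p1 N1 p1x p1K]] := span_closure_projection x.
have [p2 [pp2 p2p2 N2 p2y p2K]] := span_closure_projection y.
pose O : {linear H -> H} := (D1 \+ D2) \- (C \o D2).
have OE h : O h = D1 h + D2 h - C (D2 h) by [].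
have p12 v : p1 (p2 v) = 0.
  apply: p1K => n; apply: ip_comm0.
  by rewrite ip_rp !N2 // => k; rewrite ?ipZr oyx ?mulr0.
have p1x_ip v n : ip (p1 v) (x n) = ip v (x n).
  by rewrite symop_ip ?p1x //; exact: pp1.1.1.
have p2y_ip v n : ip (p2 v) (y n) = ip v (y n).
  by rewrite symop_ip ?p2y //; exact: pp2.1.1.
have p2x n : p2 (x n) = 0 by apply: p2K => k; exact: oyx.
have p1y n : p1 (y n) = 0 by apply: p1K => k; exact: oxy.
have p2x_ip v n : ip (p2 v) (x n) = 0.
  by rewrite symop_ip ?p2x ?linear0r //; exact: pp2.1.1.
have p1y_ip v n : ip (p1 v) (y n) = 0.
  by rewrite symop_ip ?p1y ?linear0r //; exact: pp1.1.1.
have OP v : O v = O (p1 v + p2 v).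
  apply/subr0_eq; rewrite -linearB; set w := v - _.
  have wx n : ip w (x n) = 0 by rewrite ipBl ipDl p1x_ip p2x_ip addr0 subrr.
  have wy n : ip w (y n) = 0 by rewrite ipBl ipDl p2y_ip p1y_ip add0r subrr.
  rewrite OE (series_single L1 (n := 0)) ?wx // mulr0 scale0r add0r.
  by rewrite (series_single L2 (n := 0)) ?wy // mulr0 scale0r linear0 subrr.
have Onr v : nr (O v) <= 2^-1 * nr (p1 v + p2 v).
  rewrite OP; set w := p1 v + p2 v; rewrite OE.
  rewrite (le_trans (nrD _ _)) // nrN (le_trans (lerD (nrD _ _) (bC _))) //.
  by have := b1 w; have := b2 w; have := nr_ge0 w; lra.
have coord v j : ip (O v) (x j) = (a j)%:C * (ip v (x j) + ip v (y j)) -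
    (c j)%:C * ((a (dyadic j))%:C * ip v (y (dyadic j))).
  rewrite OE ipBl ipDl.
  by rewrite (series_coord L1) // (series_coord L2) // (series_coord LC) //
    (series_coord L2) // mulrDr.
have Oinj v : O v = 0 -> p1 v + p2 v = 0.
  move=> Ov; have E j : (c j * a (dyadic j))%:C * ip v (y (dyadic j)) =
      (a j)%:C * (ip v (x j) + ip v (y j)).
    have := coord v j; rewrite Ov linear0l => /esym/eqP.
    by rewrite subr_eq0 => /eqP ->; rewrite rmorphM mulrA.
  have vy n : ip v (y n) = 0.
    (* The unit vector y 0 turns the modulus of a complex number into a real norm. *)
    set w := ip v (y n) *: y 0.
    have w_le i : a n * nr w <= 2^-1 ^+ i * nr v.
      (* When [dyadic j] is n, coordinate j of O v = 0 bounds c_j a_n |(v, y_n)| by 2 a_j |v|. Such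
         j are arbitrarily large, and a_j / c_j tends to 0. *)
      have [j ij jn] := dyadic_large n i.
      have := congr1 (fun t => nr (t *: y 0)) (E j); rewrite jn -!scalerA !nrZr.
      have ca : 0 <= c j * a n by rewrite ltW // mulr_gt0.
      rewrite -/w (ger0_norm ca) (ger0_norm (ltW (a_gt0 j))) => E1.
      have unit_le u : ip u u = 1 -> nr (ip v u *: y 0) <= nr v.
        move=> u1; have := ip_le v u.
        by rewrite !nrZ (unit_nr u1) (unit_nr (y1 0)) expr1n !mulr1.
      have le2 : c j * a n * nr w <= a j * (nr v + nr v).
        rewrite E1 scalerDl ler_pM2l //; apply: (le_trans (nrD _ _)).
        by rewrite lerD // unit_le.
      have aj : a j = c j * (4^-1 * 2^-1 ^+ j) by rewrite /a /c; field.
      have le3 : a n * nr w <= 4^-1 * 2^-1 ^+ j * (nr v + nr v).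
        by rewrite -(ler_pM2l (c_gt0 j)) mulrA (le_trans le2) // aj -[leLHS]mulrA.
      apply: (le_trans le3).
      have : 2^-1 ^+ j <= 2^-1 ^+ i :> R.
        by rewrite ler_wiXn2l ?invr_ge0 // invf_le1 ?ler1n.
      by have := nr_ge0 v; have := half_ge0 i; nra.
    have w0 : nr w = 0.
      have : a n * nr w <= 0.
        have Z : (fun i => 2^-1 ^+ i * nr v) @ \oo --> (0 : R).
          rewrite -[X in _ --> X](mul0r (nr v)).
          by apply: cvgM; [exact: half_to0|exact: cvg_cst].
        by apply: (cvgr_to_ge Z); apply: nearW.
      by rewrite pmulr_rle0 // => le0; apply/eqP; rewrite eq_le le0 nr_ge0.
    have /eqP := nr_eq0 w0; rewrite scaler_eq0 => /orP[/eqP //|/eqP y0].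
    by have := y1 0; rewrite y0 linear0l => /eqP; rewrite eq_sym oner_eq0.
  have vx n : ip v (x n) = 0.
    have /esym/eqP := E n; rewrite !vy mulr0 addr0 mulf_eq0 => /orP[|/eqP //].
    by rewrite eq_complex /= gt_eqF.
  by rewrite p1K ?p2K ?addr0 // => n; exact: ip_comm0.
exists O, p1, p2; split=> //.
  move=> v w zw; split; [apply: N1|apply: N2] => n; exact: zw.
move=> u b b0 uO.
have [||||g [m [_ _ lm]]] := @riesz O setT (rp u) b.
- exact: subspace_setT.
- by move=> t h k _ _; rewrite !rpE.
- exact: b0.
- by move=> h _; exact: uO.
have um h : rp u h = rp (O h) m by exact: lm.
(* u = O^* m, and the range of O lies in the closed span of the x_n. *)
have done : (forall n, ip (x n) m = 0) -> u = 0.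
  move=> xm; apply: rp_inj => h; rewrite rp0l um /rp OE ipBl ipDl.
  by rewrite (series_orth L1) // (series_orth L2) // (series_orth LC) // !addr0 subr0.
have um_ip h : ip u h = ip m (O h).
  by rewrite !ip_rp um -linZ um !(rpC m).
have D1y n : D1 (y n) = 0.
  by rewrite (series_single L1 (n := 0)) ?oyx ?mulr0 ?scale0r.
have D2x n : D2 (x n) = 0.
  by rewrite (series_single L2 (n := 0)) ?oxy ?mulr0 ?scale0r.
have D1x n : D1 (x n) = (a n)%:C *: x n.
  rewrite (series_single L1 (n := n)) ?x1 ?mulr1 // => j jn.
  by rewrite ox eq_sym (negbTE jn).
have D2y n : D2 (y n) = (a n)%:C *: x n.
  rewrite (series_single L2 (n := n)) ?y1 ?mulr1 // => j jn.
  by rewrite oy eq_sym (negbTE jn).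
have cancel n v : ip m ((a n)%:C *: v) = 0 -> ip v m = 0.
  rewrite ipZr => /eqP; rewrite mulf_eq0 => /orP[|/eqP/ip_comm0 //].
  by rewrite conjC_eq0 eq_complex /= gt_eqF.
(* If p1 u = u, then u is orthogonal to the y_j, so m is orthogonal to O y_j = a_j (1 - C) x_j; as C
   has norm at most 1/2, this forces p1 m = 0. If p2 u = u, then m is orthogonal to O x_n = a_n
   x_n. *)
case=> pu; apply: done => n.
  have [|C' [CC' _]] := adjoint_ex _ bC; first by rewrite invr_ge0.
  have CC'_ip h k : ip (C h) k = ip h (C' k) by rewrite !ip_rp !CC' linZ.
  have k0 j : ip (x j) (m - C' m) = 0.
    have := um_ip (y j); rewrite -[in LHS]pu p1y_ip OE D1y D2y add0r linZ -scalerBr.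
    by move=> /esym/cancel; rewrite ipBl CC'_ip ipBr.
  have p1m : p1 m = 0.
    apply: rp_eq0; have /eqP := N1 m _ k0; rewrite rpDr rpNr subr_eq0 -CC' => /eqP E.
    have F : rp (C (p1 m)) (m - p1 m) = 0.
      rewrite /rp (series_orth LC) // => j; rewrite ipBr.
      by rewrite -[in X in _ - X]symop_ip ?p1x ?subrr //; exact: pp1.1.1.
    have G : rp (p1 m) (p1 m) = rp (C (p1 m)) (p1 m).
      by rewrite pp1.1.1 p1p1 rpC E; move: F; rewrite rpDr rpNr => /subr0_eq.
    have := ler_norm (rp (C (p1 m)) (p1 m)); have := rp_le (C (p1 m)) (p1 m).
    have := bC (p1 m); have := nr_ge0 (p1 m); rewrite -G -sqr_nr.
    by nra.
  by rewrite -(p1x n) symop_ip ?p1m ?linear0r //; exact: pp1.1.1.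
apply: (cancel n); have := um_ip (x n); rewrite -[in LHS]pu p2x_ip OE D1x D2x.
by rewrite linear0 subr0 addr0.
Qed.

End Twisted.

(* Z = 1 - (p1 + p2) + O^* O. *)
Lemma twisted_ex (z : nat -> H) : (forall i j, ip (z i) (z j) = (i == j)%:R) ->
  exists Z p1 p2 : {linear H -> H},
  [/\ [/\ pcop Z, pcop p1, pcop p2, forall v, p1 (p1 v) = p1 v
        & forall v, p2 (p2 v) = p2 v],
      forall w, (forall n, ip (z n) w = 0) -> p1 w = 0 /\ p2 w = 0,
      forall v, Z (v - (p1 v + p2 v)) = v - (p1 v + p2 v) /\
        (rp (Z v) v = 0 -> v = 0),
      exists2 v, Z v != v & p1 v + p2 v = v
    & forall u, oran Z u -> p1 u = u \/ p2 u = u -> u = 0].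
Proof.
move=> oz; have [T [p1 [p2 [[pp1 pp2 p1p1 p2p2 p12] zK [p1x Onr] Oinj Oran]]]] :=
  twisted_contraction oz.
have p21 v : p2 (p1 v) = 0.
  by apply: rp_inj => h; rewrite pp2.1.1 pp1.1.1 p12 rp0r rp0l.
have O1 h : nr (T h) <= 1 * nr h.
  apply: (le_trans (Onr h)).
  have := pcop_nr h pp1; have := pcop_nr h pp2; have := nrD (p1 h) (p2 h).
  by have := nr_ge0 h; lra.
have [T' [TT' _]] := adjoint_ex ler01 O1.
have [P PE] : exists P : {linear H -> H}, forall v, P v = p1 v + p2 v.
  by exists (p1 \+ p2).
have sP : symop P by move=> v w; rewrite !PE !rpE pp1.1.1 pp2.1.1.
have PP v : P (P v) = P v.
  by rewrite !PE !linearD p1p1 p2p2 p12 p21 addr0 add0r.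
have [Z ZE] : exists Z : {linear H -> H}, forall v, Z v = v - P v + T' (T v).
  by exists ((idfun \- P) \+ (T' \o T)).
have OP v : T (v - P v) = 0.
  have := Onr (v - P v); rewrite -PE (linearB P) PP subrr nr0 mulr0 => le0.
  by apply: nr_eq0; apply/eqP; rewrite eq_le le0 nr_ge0.
have Zq v : rp (Z v) v = rp (v - P v) (v - P v) + rp (T v) (T v).
  rewrite ZE rpDl [rp (T' _) _]rpC -TT'; congr (_ + _).
  rewrite [RHS]rpDr rpNr -[X in _ = _ - X]sP linearB PP subrr rp0l subr0 //.
have Ole v : rp (T v) (T v) <= rp (P v) (P v).
  rewrite -!sqr_nr ler_pXn2r ?nnegrE ?nr_ge0 //.
  by have := Onr v; rewrite -PE; have := nr_ge0 (P v); lra.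
have pyth v : rp v v = rp (v - P v) (v - P v) + rp (P v) (P v).
  have PPv : rp (P v) v = rp (P v) (P v) by rewrite -{1}PP sP.
  by rewrite !rpE (rpC v (P v)) PPv; ring.
exists Z, p1, p2; split=> //.
- split=> //; split; first split=> [v w|v]; last 2 first.
  + by rewrite Zq addr_ge0 ?rpxx_ge0.
  + by move=> v; rewrite Zq [leRHS]pyth lerD2l.
  by rewrite !ZE !rpE sP (rpC (T' _)) -!TT' (rpC (T w)).
- move=> w zw; split; apply: rp_eq0.
    by rewrite pp1.1.1 p1p1 rpC; exact: (zK w w zw).1.
  by rewrite pp2.1.1 p2p2 rpC; exact: (zK w w zw).2.
- move=> v; rewrite -PE ZE linearB PP subrr subr0 OP linear0 addr0; split=> //.
  rewrite Zq => /eqP; rewrite paddr_eq0 ?rpxx_ge0 // => /andP[/eqP/rp_eq0 vP /eqP/rp_eq0].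
  by move=> /Oinj; rewrite -PE; move: vP => /subr0_eq {2}->.
- have p1z : p1 (z 0) = z 0 := p1x.
  have p2z : p2 (z 0) = 0 by rewrite -p1z p21.
  exists (z 0); last by rewrite p1z p2z addr0.
  (* Z z_0 = z_0 would give |O z_0| = |z_0| = 1, against the bound 1/2. *)
  apply/eqP => Zz; have := Zq (z 0); rewrite Zz pyth.
  have z1 : rp (z 0) (z 0) = 1 by rewrite /rp oz.
  have Pz : P (z 0) = z 0 by rewrite PE p1z p2z addr0.
  rewrite Pz subrr rp0l !add0r z1 -sqr_nr => E.
  have := Onr (z 0); rewrite -PE Pz (unit_nr (oz 0 0)).
  by have := nr_ge0 (T (z 0)); nra.
move=> u [c c0 uc] pu; apply: (Oran u c) => // h.
have Pu : P u = u.
  by rewrite PE; case: pu => <-; rewrite ?p1p1 ?p2p2 ?p21 ?p12 ?addr0 ?add0r.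
(* u is fixed by P, so h may be replaced by P h, where the form of Z is |O h|^2. *)
have := uc (P h); rewrite -sP Pu Zq PP subrr rp0l add0r => /le_trans; apply.
have -> : T (P h) = T h.
  by apply/esym/subr0_eq; rewrite -linearB.
exact: lexx.
Qed.

(** * A decomposition with nonzero outer summands *)

Section SecondPair.
Variables (D : {linear H -> H}) (z : nat -> H).
Hypotheses (pD : pcop D) (oz : forall i j, ip (z i) (z j) = (i == j)%:R).
Hypothesis zD : forall n g, D g = 0 -> rp (z n) g = 0.

(** Since p1 + p2 fixes ran k and k^2 = 1 - Z, the factors k p1 k + Z + k p2 k between the two Q add
    up to 1. Injectivity of Z reduces ker E to ker Q = ker D. If D0 and D1 both vanished, k would be
    0 and Z the identity. *)
Lemma twisted_decomposition : exists D0 E D1 : {linear H -> H},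
  [/\ [/\ posop D0, posop E & posop D1],
      forall h, D0 h + E h + D1 h = D h,
      forall h, E h = 0 -> D h = 0,
      (forall u, oran E u -> oran D0 u -> u = 0) /\
        (forall u, oran E u -> oran D1 u -> u = 0)
    & ~ ((forall h, D0 h = 0) /\ (forall h, D1 h = 0))].
Proof.
have [Z [p1 [p2 [[pZ pp1 pp2 p1p1 p2p2] zK Zc [v0 Zv0 pv0] Zran]]]] := twisted_ex oz.
have [Q [pQ QQ _]] := sqrtop pD.
have [V [k [pV pk VV kk Vk]]] := sqrtop_pair pZ.
have [Pi [PiK orth]] := projection (@subspace_orthker D) (@seq_closed_orthker D).
have zn g : D g = 0 -> forall n, ip (z n) g = 0.
  by move=> Dg n; rewrite ip_rp !zD // linZ Dg scaler0.
have p1D g : D g = 0 -> p1 g = 0 by move=> /zn/zK[].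
have p2D g : D g = 0 -> p2 g = 0 by move=> /zn/zK[].
have Kp1 v : orthker D (p1 v) by move=> g /p1D pg; rewrite pp1.1.1 pg rp0r.
have Kp2 v : orthker D (p2 v) by move=> g /p2D pg; rewrite pp2.1.1 pg rp0r.
have kP v : k v = k (p1 v + p2 v).
  apply/subr0_eq; rewrite -linearB; apply: rp_eq0; rewrite pk.1.1 kk.
  by rewrite (Zc v).1 subrr rp0r.
have Pk v : p1 (k v) + p2 (k v) = k v.
  by apply: rp_inj => h; rewrite rpDl pp1.1.1 pp2.1.1 -rpDr pk.1.1 -kP -pk.1.1.
have Kk v : orthker D (k v).
  by rewrite -Pk; exact: (subspaceD (@subspace_orthker D)).
pose D0 : {linear H -> H} := Q \o (k \o (p1 \o (k \o Q))).
pose D1 : {linear H -> H} := Q \o (k \o (p2 \o (k \o Q))).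
pose E : {linear H -> H} := Q \o (Z \o Q).
have D0E h : D0 h = Q (k (p1 (k (Q h)))) by [].
have D1E h : D1 h = Q (k (p2 (k (Q h)))) by [].
have EE h : E h = Q (Z (Q h)) by [].
have D0q h : rp (D0 h) h = rp (p1 (k (Q h))) (p1 (k (Q h))).
  by rewrite D0E pQ.1.1 pk.1.1 -{1}p1p1 pp1.1.1.
have D1q h : rp (D1 h) h = rp (p2 (k (Q h))) (p2 (k (Q h))).
  by rewrite D1E pQ.1.1 pk.1.1 -{1}p2p2 pp2.1.1.
have Eq h : rp (E h) h = rp (Z (Q h)) (Q h) by rewrite EE pQ.1.1.
(* A common element is u = Q k n with n in ran p; then k n is in ran Z^{1/2},
   and so is n = k^2 n + Z n. *)
have disj (p : {linear H -> H}) u : pcop p -> (forall v, p (p v) = p v) ->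
    (forall v, orthker D (p v)) -> (forall u, oran Z u -> p u = u -> u = 0) ->
    oran E u -> forall b, 0 <= b ->
    (forall h, rp u h ^+ 2 <= b * rp (p (k (Q h))) (p (k (Q h)))) -> u = 0.
  move=> pp ppp Kp pran [c c0 uc] b b0 ub.
  pose W : {linear H -> H} := p \o (k \o Q).
  have [||||g [m [_ _ lm]]] := @riesz W setT (rp u) b.
  - exact: subspace_setT.
  - by move=> t x y _ _; rewrite !rpE.
  - exact: b0.
  - by move=> h _; exact: ub.
  have uE : u = Q (k (p m)).
    apply: rp_inj => h; rewrite (lm h I) /W /= pp.1.1 pk.1.1 pQ.1.1 rpC //.
  set n := p m in uE.
  (* On ran Q this is the bound for u; it extends to [orthker D] by density. On the complement Z is
     the identity and k n has no component, so only the right-hand side grows. *)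
  have knZ h : rp (k n) h ^+ 2 <= c * rp (Z h) h.
    have KPi : orthker D (Pi h) by exact: PiK.
    have [f Kf Qf] := orthker_approx pD pQ QQ KPi.
    have lim1 : rp (k n) (Pi h) ^+ 2 <= c * rp (Z (Pi h)) (Pi h).
      have L1 : (fun i => rp (k n) (Q (f i)) ^+ 2) @ \oo --> rp (k n) (Pi h) ^+ 2.
        by rewrite expr2; under eq_fun do rewrite expr2; apply: cvgM;
          exact: cvs_rp (cvs_cst _) Qf.
      have L2 : (fun i => c * rp (Z (Q (f i))) (Q (f i))) @ \oo -->
          c * rp (Z (Pi h)) (Pi h).
        apply: cvgM; first exact: cvg_cst.
        by apply: cvs_rp => //; exact: (cvs_bnd (fun h => pcop_nr h pZ) Qf).
      apply: (ler_cvg_to L1 L2); apply: nearW => i.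
      by have := uc (f i); rewrite uE Eq pQ.1.1.
    have w_orth x : orthker D x -> rp (h - Pi h) x = 0 by exact: orth.
    have Zw : Z (h - Pi h) = h - Pi h.
      have := (Zc (h - Pi h)).1.
      have -> : p1 (h - Pi h) = 0.
        by apply: rp_eq0; rewrite pp1.1.1 w_orth //.
      have -> : p2 (h - Pi h) = 0.
        by apply: rp_eq0; rewrite pp2.1.1 w_orth //.
      by rewrite addr0 subr0.
    have -> : rp (k n) h = rp (k n) (Pi h).
      by apply/subr0_eq; rewrite -rpNr -rpDr rpC w_orth.
    apply: (le_trans lim1); apply: ler_wpM2l => //.
    have -> : rp (Z h) h = rp (Z (Pi h)) (Pi h) + rp (h - Pi h) (h - Pi h).
      have wE : h - Pi h + Pi h = h by rewrite subrK.
      move: (h - Pi h) Zw w_orth wE => w Zw w_orth wE.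
      have -> : rp (Z h) h = rp (w + Z (Pi h)) (w + Pi h).
        by rewrite -{1}Zw -linearD wE.
      have ZPw : rp (Z (Pi h)) w = 0 by rewrite pZ.1.1 Zw rpC w_orth.
      by rewrite rpDl !rpDr ZPw (w_orth (Pi h)) //; ring.
    by rewrite lerDl rpxx_ge0.
  have nZ : oran Z n.
    (* From n = k k n + V V n and (s + t)^2 <= 2 s^2 + 2 t^2. *)
    exists (2 * c + 2 * rp (V n) (V n)) => [|h].
      by rewrite addr_ge0 ?mulr_ge0 ?rpxx_ge0.
    have nE : rp n h = rp (k n) (k h) + rp (V n) (V h).
      by rewrite pk.1.1 kk pV.1.1 VV rpDr rpNr subrK.
    have le1 : rp (k n) (k h) ^+ 2 <= c * rp (V h) (V h).
      apply: (le_trans (knZ _)); apply: ler_wpM2l => //.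
      rewrite -VV pV.1.1 Vk -!sqr_nr ler_pXn2r ?nnegrE ?nr_ge0 //.
      by have := pcop_nr (V h) pk; rewrite mul1r.
    have le2 := rp_sqr_le (V n) (V h).
    rewrite nE -[rp (Z h) h](_ : rp (V h) (V h) = _); last by rewrite pV.1.1 VV rpC.
    have := sqr_ge0 (rp (k n) (k h) - rp (V n) (V h)); lra.
  have n0 : n = 0 by apply: pran => //; rewrite /n ppp.
  by rewrite uE n0 !linear0.
exists D0, E, D1; split.
- split; split=> [x y|h].
  + by rewrite !D0E pQ.1.1 pk.1.1 pp1.1.1 pk.1.1 pQ.1.1.
  + by rewrite D0q rpxx_ge0.
  + by rewrite !EE pQ.1.1 pZ.1.1 pQ.1.1.
  + by rewrite Eq; exact: pZ.1.2.
  + by rewrite !D1E pQ.1.1 pk.1.1 pp2.1.1 pk.1.1 pQ.1.1.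
  + by rewrite D1q rpxx_ge0.
- move=> h; rewrite D0E D1E EE addrAC -!linearD Pk kk subrK; exact: QQ.
- move=> h Eh; apply/(kerX pQ QQ); apply: (Zc _).2.
  by rewrite -Eq Eh rp0l.
- split=> u Eu [b b0 ub].
    apply: (disj p1 u pp1 p1p1 Kp1 _ Eu b b0) => [v Zv pv|h].
      by apply: Zran => //; left.
    by rewrite -D0q.
  apply: (disj p2 u pp2 p2p2 Kp2 _ Eu b b0) => [v Zv pv|h].
    by apply: Zran => //; right.
  by rewrite -D1q.
move=> [D00 D10]; have kQ h : k (Q h) = 0.
  rewrite -Pk; have -> : p1 (k (Q h)) = 0.
    by apply: rp_eq0; rewrite -D0q D00 rp0l.
  have -> : p2 (k (Q h)) = 0 by apply: rp_eq0; rewrite -D1q D10 rp0l.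
  exact: addr0.
have k0 h : k h = 0.
  apply: (orthker_eq0 (Kk h)); apply/(kerX pQ QQ).
  by apply: rp_inj => g; rewrite pQ.1.1 pk.1.1 kQ rp0r rp0l.
by move/eqP: Zv0; apply; apply/esym/subr0_eq; rewrite -kk k0.
Qed.

End SecondPair.

(** * Infinite defect *)

(** The last hypothesis makes the range dense, and the lower bound makes it closed. *)
Lemma linear_surjective (C : {linear H -> H}) (b c : R) : 0 <= c ->
    (forall h, nr h <= b * nr (C h)) -> (forall h, nr (C h) <= c * nr h) ->
    (forall k, (forall h, rp (C h) k = 0) -> k = 0) ->
  forall e, exists d, C d = e.
Proof.
move=> c0 Cb Cc Ck e.
have [||||g [m [_ gm lm]]] := @riesz C setT (fun h => rp (C h) e) (rp e e).
- exact: subspace_setT.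
- by move=> t x y _ _; rewrite linearP !rpE.
- exact: rpxx_ge0.
- by move=> h _; rewrite mulrC rp_sqr_le.
have em : e = m.
  by apply/subr0_eq/Ck => h; rewrite rpDr rpNr lm // subrr.
have [||d gd] := @complete_rate (fun n => b * nr (C (g n) - m)) g.
- by rewrite -[X in _ --> X](mulr0 b); apply: cvgM; [exact: cvg_cst|exact: gm].
- move=> n k; apply: (le_trans (Cb _)); rewrite linearB -mulrDr.
  (* A negative b is possible only when H is trivial. *)
  have b0 : 0 <= b \/ forall h, nr h = 0.
    have [b0|b0] := leP 0 b; [by left|right=> h].
    apply/eqP; rewrite eq_le nr_ge0 andbT (le_trans (Cb h)) //.
    by rewrite mulr_le0_ge0 ?nr_ge0 // ltW.
  case: b0 => [b0|Z]; last by rewrite !Z addr0.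
  by apply: ler_wpM2l => //; rewrite (nrB (C (g k))) nr_dist.
exists d; rewrite em; exact: (cvs_unique (cvs_bnd Cc gd) gm).
Qed.

Lemma finite_dim_image (C : {linear H -> H}) (N M : set H) :
    (forall e, exists d, C d = e) -> (forall h, C h = 0 -> h = 0) ->
    (forall h, N h -> M (C h)) -> finite_dim M -> finite_dim N.
Proof.
move=> Csurj Cinj NM [n [e Me]].
have /choice[d dP] : forall k, exists d, C d = e k by move=> k; exact: Csurj.
exists n, d => h Nh; have [c _ cE] := Me _ (NM _ Nh); exists c => //.
apply/subr0_eq/Cinj; rewrite linearB -cE linear_sum.
apply/eqP; rewrite subr_eq0; apply/eqP; apply: eq_bigr => k _.
by rewrite linZ dP.
Qed.

Definition orthonormal (s : seq H) :=
  forall i j, (i < size s)%N -> (j < size s)%N -> ip s`_i s`_j = (i == j)%:R.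

(** If the Gram-Schmidt remainder w vanished for every h in N, then s would span N. *)
Lemma orthonormal_extend (N : set H) s : subspace N -> ~ finite_dim N ->
    (forall i, (i < size s)%N -> N s`_i) -> orthonormal s ->
  exists v, [/\ N v, ip v v = 1 & forall i, (i < size s)%N -> ip v s`_i = 0].
Proof.
move=> sN infN Ns os; apply: contrapT => none; apply: infN.
exists (size s), (fun k => s`_k) => h Nh.
pose w := h - \sum_(k < size s) ip h s`_k *: s`_k.
exists (fun k : 'I__ => ip h s`_k) => //; apply/esym/subr0_eq.
rewrite -/w; apply: contrapT => w0; apply: none.
have Nw : N w.
  apply: subspaceB => //; elim/big_ind: _ => [|x y Nx Ny|k _].
  - exact: sN.1.
  - exact: subspaceD.
  - by apply: subspaceZ => //; exact: Ns.
have ws i : (i < size s)%N -> ip w s`_i = 0.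
  move=> si; rewrite ipBl (_ : ip (\sum_(k < _) _) _ = ip h s`_i) ?subrr //.
  have -> : ip (\sum_(k < size s) ip h s`_k *: s`_k) s`_i =
      \sum_(k < size s) ip h s`_k * ip s`_k s`_i.
    elim/big_ind2: _ => [|u a v b <- <-|k _]; rewrite ?linear0l ?ipDl ?ipZl //.
  rewrite (bigD1 (Ordinal si)) //= os // eqxx mulr1 big1 ?addr0 // => k ki.
  by rewrite os // (negbTE (ki : (k : nat) != i)) mulr0.
have nw : nr w != 0 by apply/eqP => /nr_eq0.
exists ((nr w)^-1%:C *: w); split=> [||i si].
- exact: subspaceZ.
- rewrite ip_xx rpZl rpZr -sqr_nr (_ : _ * _ = 1) //.
  by field.
- by rewrite ipZl ws // mulr0.
Qed.

Lemma orthonormal_seq (N : set H) : subspace N -> ~ finite_dim N ->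
  exists z : nat -> H, (forall n, N (z n)) /\
    forall i j, ip (z i) (z j) = (i == j)%:R.
Proof.
move=> sN infN.
pose good s := (forall i, (i < size s)%N -> N s`_i) /\ orthonormal s.
have /choice[f fP] : forall s : seq H, exists v, good s ->
    [/\ N v, ip v v = 1 & forall i, (i < size s)%N -> ip v s`_i = 0].
  move=> s; have [[Ns os]|bad] := pselect (good s); last by exists 0.
  by have [v vP] := orthonormal_extend sN infN Ns os; exists v.
have [l [l0 lf]] : exists l : nat -> seq H,
    l 0 = [::] /\ forall n, l n.+1 = rcons (l n) (f (l n)).
  by exists (fix l n := if n is n'.+1 then rcons (l n') (f (l n')) else [::]).
have [z zE] : exists z : nat -> H, forall n, f (l n) = z n by exists (f \o l).
have lS n : l n.+1 = rcons (l n) (z n) by rewrite lf zE.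
have size_l n : size (l n) = n.
  by elim: n => [|n IH]; rewrite ?l0 // lS size_rcons IH.
have nth_l n i : (i < n)%N -> (l n)`_i = z i.
  elim: n => // n IH; rewrite ltnS leq_eqVlt => /orP[/eqP ->|lt].
    by rewrite lS nth_rcons size_l ltnn eqxx.
  by rewrite lS nth_rcons size_l lt IH.
have good_l n : good (l n).
  elim: n => [|n IH]; first by rewrite l0; split.
  have := fP _ IH; rewrite zE => -[Nz z1 zl]; have [Ns os] := IH; split.
    move=> i; rewrite size_l ltnS leq_eqVlt => /orP[/eqP ->|lt].
      by rewrite nth_l.
    rewrite (nth_l n.+1 i (ltnW lt)) -(nth_l n i lt); apply: Ns.
    by rewrite size_l.
  have zz i : (i < n)%N -> ip (z n) (z i) = 0.
    by move=> lt; rewrite -(nth_l n i lt) zl // size_l.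
  move=> i j; rewrite size_l => li lj; rewrite (nth_l _ _ li) (nth_l _ _ lj).
  move: li lj; rewrite !ltnS (leq_eqVlt i) (leq_eqVlt j).
  move=> /orP[/eqP ->|li] /orP[/eqP ->|lj].
  - by rewrite eqxx z1.
  - by rewrite zz // gtn_eqF.
  - by rewrite (ip_comm0 (zz _ li)) ltn_eqF.
  - by rewrite -(nth_l n i li) -(nth_l n j lj) os // size_l.
exists z; split=> [n|i j].
  by have := fP _ (good_l n); rewrite zE => -[].
have li : (i < (maxn i j).+1)%N by rewrite ltnS leq_maxl.
have lj : (j < (maxn i j).+1)%N by rewrite ltnS leq_maxr.
rewrite -(nth_l _ _ li) -(nth_l _ _ lj).
by apply: (good_l (maxn i j).+1).2; rewrite size_l.
Qed.

Lemma rel_inj (G G' : {linear H -> H}) : rel G = rel G' -> forall h, G h = G' h.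
Proof.
move=> GG' h; have := rel_image G h; rewrite GG' /rel /= => E.
by rewrite {1}E addrC subrK.
Qed.

(** C = 1 - (1 + i) Ga is (T - i) (T + 1)^{-1} for T = [rel Ga]. Its adjoint maps (S + 1) f to (S +
    i) f, so C maps the defect space at i into the orthogonal complement of ran (S + 1). It is
    bijective, because |C h|^2 = |h - Ga h|^2 + |Ga h|^2 bounds it below and its adjoint is
    injective. *)
Lemma coincidence_defect_infinite (Ga Gb : {linear H -> H}) : pcop Ga ->
    ~ finite_dim (defect_space ip (rel Ga `&` rel Gb) 'i) ->
  ~ finite_dim [set h | forall g, coincidence Ga Gb g -> rp h g = 0].
Proof.
move=> pG infi fin; apply: infi.
have [C CE] : exists C : {linear H -> H}, forall h, C h = h - Ga h - 'i *: Ga h.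
  by exists ((idfun \- Ga) \- ('i \*: Ga)).
have i0 h : rp h ('i *: h) = 0.
  by apply: (@symop_i0 idfun).
have iG0 h : rp h ('i *: Ga h) = 0.
  by rewrite -linZ -pG.1.1 symop_i0 //; exact: pG.1.1.
have Csq h : rp (C h) (C h) = rp (h - Ga h) (h - Ga h) + rp (Ga h) (Ga h).
  rewrite CE; have : rp (h - Ga h) ('i *: Ga h) = 0.
    by rewrite rpDl rpNl iG0 i0 subrr.
  move: (h - Ga h) => v v0.
  by rewrite !rpE rp_i v0 (rpC _ v) v0; ring.
have Cb h : nr h <= 2 * nr (C h).
  apply: ler_of_sqr; first by rewrite mulr_ge0 ?nr_ge0.
  rewrite exprMn !sqr_nr Csq.
  have := rpxx_ge0 (h - Ga h - Ga h); have := rpxx_ge0 (h - Ga h).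
  have := rpxx_ge0 (Ga h); have := rpxx_ge0 h.
  rewrite !rpE (rpC (Ga h) h); lra.
have Cc h : nr (C h) <= 1 * nr h.
  rewrite mul1r; apply: ler_of_sqr; rewrite ?nr_ge0 // !sqr_nr Csq !rpE.
  have := pcop_sqr h pG; have := pG.1.2 h; rewrite (rpC h (Ga h)); lra.
apply: (finite_dim_image (C := C) _ _ _ fin).
- apply: (linear_surjective ler01 Cb Cc) => k Ck.
  have Gk : rp (Ga k) k = 0.
    have := Ck ('i *: k); rewrite CE (linZ Ga) scalerA.
    have -> : 'i * 'i = -1 :> R[i] by rewrite -expr2 sqr_i.
    rewrite scaleN1r opprK !rpDl rpNl (rpC ('i *: k)) i0 (rpC ('i *: Ga k)) iG0.
    by lra.
  have := Ck k; rewrite CE !rpDl !rpNl (rpC ('i *: _)) iG0 Gk !subr0.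
  exact: rp_eq0.
- move=> h Ch; apply: nr_eq0; apply/eqP; rewrite eq_le nr_ge0 andbT.
  by rewrite (le_trans (Cb h)) // Ch nr0 mulr0.
move=> h hi g Cg; rewrite CE.
have Sg : (rel Ga `&` rel Gb) (Ga g, g - Ga g).
  split; first exact: rel_image.
  by rewrite /rel /= addrC subrK.
have /(congr1 (@complex.Re R)) := hi _ Sg; rewrite -/(rp _ _) /=.
rewrite !rpDl !rpNl.
have -> : rp ('i *: Ga g) h = - rp ('i *: Ga h) g.
  have := rp_i ('i *: Ga g) h; rewrite scalerA.
  have -> : 'i * 'i = -1 :> R[i] by rewrite -expr2 sqr_i.
  rewrite scaleN1r rpNl => <-; rewrite -linZ; congr (- _).
  by rewrite pG.1.1 linZ rpC.
rewrite (rpC g h) pG.1.1 (rpC g); lra.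
Qed.

(** * The pairs of extensions *)

Lemma two_pairs (S T0 T1 : set (H * H)) :
    nonneg_sa_extension ip S T0 -> nonneg_sa_extension ip S T1 -> T0 `&` T1 = S ->
  (exists S0 S1, disjoint_restriction_pair ip S S0 S1) /\
  (~ finite_dim (defect_space ip S 'i) ->
   exists S0 S1 S0' S1', [/\ disjoint_restriction_pair ip S S0 S1,
     disjoint_restriction_pair ip S S0' S1' & (S0, S1) <> (S0', S1')]).
Proof.
move=> [_ sa0 nn0] [_ sa1 nn1] TS.
have [Ga pa T0E] := resolvent sa0 nn0; have [Gb pb T1E] := resolvent sa1 nn1.
rewrite {}T0E {}T1E in TS; rewrite -TS.
have [G GE] : exists G : {linear H -> H}, forall h, G h = (2^-1)%:C *: (Ga h + Gb h).
  by exists ((2^-1)%:C \*: (Ga \+ Gb)).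
have [G' G'E] : exists G' : {linear H -> H}, forall h, G' h = h - G h.
  by exists (idfun \- G).
have pG := pcop_mean pa pb GE; have pG' := pcop_comean pa pb GE G'E.
have sC := subspace_coincidence Ga Gb.
have [B shB] := shorted_ex sC pG; have [B' shB'] := shorted_ex sC pG'.
have [pB BG _ _] := shB; have [pB' BG' _ _] := shB'.
have [D DE] : exists D : {linear H -> H}, forall h, D h = B h + B' h.
  by exists (B \+ B').
have pD : pcop D.
  split; first split=> [x y|h].
  - by rewrite !DE !rpE pB.1 pB'.1.
  - by rewrite DE rpDl addr_ge0 //; [exact: pB.2|exact: pB'.2].
  move=> h; rewrite DE rpDl; have := BG h; have := BG' h.
  by rewrite G'E rpDl rpNl; lra.
have Dker h : D h = 0 -> coincidence Ga Gb h.
  move=> Dh; apply: (shorted_ker pa pb GE shB shB').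
  by rewrite -rpDl -DE Dh rp0l.
have [Z ZE] : exists Z : {linear H -> H}, forall h, Z h = 0.
  by apply: (@linear_ex (fun=> 0)) => a x y; rewrite scaler0 addr0.
have pZ : posop Z by split=> [x y|h]; rewrite !ZE ?rp0l ?rp0r.
have oranZ u : oran Z u -> u = 0.
  move=> [c c0 uc]; apply: rp_eq0; apply/eqP.
  by rewrite -sqrf_eq0 eq_le sqr_ge0 andbT (le_trans (uc u)) // ZE rp0l mulr0.
have pair1 := pair_of_decomposition pa pb GE G'E shB shB' pZ pD.1 pZ.
have {}pair1 := pair1 _ Dker (fun u _ => @oranZ u) (fun u _ => @oranZ u).
have ZD h : Z h + D h + Z h = B h + B' h by rewrite !ZE addr0 add0r DE.
have {}pair1 := pair1 ZD.
split; first by do 2 eexists; exact: pair1.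
move=> /(coincidence_defect_infinite pa) infN.
have [z [zN oz]] := orthonormal_seq (subspace_orth sC) infN.
have zD n g : D g = 0 -> rp (z n) g = 0 by move=> /Dker; exact: zN.
have [D0 [E [D1 [[p0 pE p1] sumD kerE [dis0 dis1] nz]]]] :=
  twisted_decomposition pD oz zD.
have pair2 := pair_of_decomposition pa pb GE G'E shB shB' p0 pE p1.
have {}pair2 : _ := pair2 _ (fun h Eh => Dker h (kerE h Eh)) dis0 dis1.
have sumB h : D0 h + E h + D1 h = B h + B' h by rewrite sumD DE.
have {}pair2 := pair2 sumB.
do 4 eexists; split; [exact: pair1|exact: pair2|].
(* Equal first resolvents give D0 = 0; equal second ones then give E = D, so that D1 = 0. *)
move=> [/rel_inj e0 /rel_inj e1]; apply: nz.
have D00 h : D0 h = 0.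
  by have := e0 h; rewrite /= ZE => /addrI <-.
split=> // h.
have := e1 h; rewrite /= ZE D00 => /addrI Dh.
have := sumD h; rewrite D00 add0r Dh => /eqP; rewrite -subr_eq0 addrAC subrr add0r.
by move=> /eqP.
Qed.

End HilbertSpace.

Theorem corollary4p3 (R : realType) (H : completeNormedModType R[i])
    (ip : {dot H for Num.conj})
    (norm_ip : forall x : H, `|x| ^+ 2 = ip x x)
    (sepH : separable H)
    (S : set (H * H))
    (linS : linear_relation S)
    (opS : is_operator S)
    (closedS : closed S)
    (symS : symmetric_relation ip S)
    (nonnegS : nonnegative ip S)
    (disjS : exists T0 T1 : set (H * H),
        [/\ nonneg_sa_extension ip S T0, nonneg_sa_extension ip S T1,
            is_operator T0, is_operator T1 & T0 `&` T1 = S]) :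
  (exists S0 S1 : set (H * H), disjoint_restriction_pair ip S S0 S1) /\
  (~ finite_dim (defect_space ip S 'i) ->
   ~ finite_dim (defect_space ip S (- 'i)) ->
   exists S0 S1 : set (H * H),
     disjoint_restriction_pair ip S S0 S1 /\
     (S0, S1) <> (Friedrichs ip S, Krein ip S)).
Proof.
have [T0 [T1 [e0 e1 _ _ TS]]] := disjS.
have [pair1 pairs] := two_pairs norm_ip e0 e1 TS; split=> // infi _.
(* The statement uses the generic imaginary unit, [two_pairs] the concrete one of [R[i]]. *)
have [|S0 [S1 [S0' [S1' [p p' ne]]]]] := pairs; first by rewrite complexiE.
have [eFK|] := pselect ((S0, S1) = (Friedrichs ip S, Krein ip S)).
  by exists S0', S1'; split=> //; rewrite -eFK => /esym.
by exists S0, S1.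
Qed.
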